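(* Let $f:\mathbb{R}^n\to\mathbb{R}$, $g:\mathbb{R}^n\to(-\infty,\infty]$, $L>0$, $l\in\mathbb{R}$ and $\gamma>0$ satisfy the standing assumptions in the context, and let $\{(y^t,z^t,x^t)\}_{t\ge1}$ be any sequence generated by the Douglas-Rachford splitting method (defined in the context) with step-size parameter $\gamma$ from an initial point $x^0\in\mathbb{R}^n$. Suppose that $$(1+\gamma L)^2+\frac{5\gamma l}{2}-\frac32<0$$ and that the sequence $\{(y^t,z^t,x^t)\}$ has a cluster point $(y^*,z^*,x^* )$. Suppose in addition that $f$ and $g$ are semi-algebraic functions. Then the whole sequence $\{(y^t,z^t,x^t)\}$ is convergent.
   Context: Standing assumptions. $f:\mathbb{R}^n\to\mathbb{R}$ is continuously differentiable and $\nabla f$ is Lipschitz continuous with a Lipschitz modulus bounded by $L>0$. $l\in\mathbb{R}$ is such that $f+\frac l2\|\cdot\|^2$ is convex. $g:\mathbb{R}^n\to(-\infty,\infty]$ is proper (its domain $\{g<+\infty\}$ is nonempty) and closed (lower semicontinuous). For the given $\gamma>0$ and every $w\in\mathbb{R}^n$, the problem $\min_u\{\gamma g(u)+\frac12\|u-w\|^2\}$ has a minimizer. Douglas-Rachford splitting method. Given $x^0\in\mathbb{R}^n$ and $\gamma>0$, for $t=0,1,2,\dots$ choose $$y^{t+1}\in\operatorname{Arg\,min}_y\Big\{f(y)+\tfrac1{2\gamma}\|y-x^t\|^2\Big\},\quad z^{t+1}\in\operatorname{Arg\,min}_z\Big\{g(z)+\tfrac1{2\gamma}\|2y^{t+1}-x^t-z\|^2\Big\},\quad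 x^{t+1}=x^t+(z^{t+1}-y^{t+1}).$$ Semi-algebraic. A set $S\subseteq\mathbb{R}^n$ is semi-algebraic if it is a finite union of sets of the form $\{x: h_1(x)=\dots=h_k(x)=0,\ g_1(x)<0,\dots,g_r(x)<0\}$ with real polynomials $h_i,g_j$. A function $F:\mathbb{R}^n\to(-\infty,\infty]$ is semi-algebraic if its graph $\{(x,F(x)): F(x)<\infty\}\subseteq\mathbb{R}^{n+1}$ is semi-algebraic. *)

(* Defs.v *)
From HB Require Import structures.
From mathcomp Require Import all_boot all_order all_algebra.
From mathcomp Require Import all_classical all_reals all_analysis.
(* mpoly is not imported: its notations clash with MathComp-Analysis; a proof
   can [Import (canonicals) mpoly] to get the algebraic structures. *)
From mathcomp Require mpoly.

Set Implicit Arguments.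
Unset Strict Implicit.
Unset Printing Implicit Defensive.

Import Order.TTheory GRing.Theory Num.Theory.
Import numFieldNormedType.Exports.

Local Open Scope classical_set_scope.
Local Open Scope ring_scope.

(* The library norm `|v| on 'rV[R]_n is the max norm, hence a separate
   Euclidean norm; both induce the same topology. *)
Definition enorm (R : realType) (n : nat) (v : 'rV[R]_n) : R :=
  Num.sqrt (\sum_(i < n) v 0 i ^+ 2).

Definition grad (R : realType) (n : nat) (f : 'rV[R]_n -> R) (x : 'rV[R]_n) :
    'rV[R]_n :=
  \row_(i < n) 'D_(delta_mx 0 i) f x.

Definition argmin (d : Order.disp_t) (T : Type) (V : porderType d)
    (F : T -> V) : set T :=
  [set x | forall y, (F x <= F y)%O].

(* Each pair (hs, gs) in s encodes the set where all polynomials in hs vanish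
   and all polynomials in gs are negative. *)
Definition semialgebraic_set (R : realType) (m : nat) (S : set 'rV[R]_m) : Prop :=
  exists s : seq (seq (mpoly.mpoly m R) * seq (mpoly.mpoly m R)),
    S = [set x | has (fun c =>
                  all (fun h => mpoly.meval (x 0) h == 0) c.1 &&
                  all (fun g => mpoly.meval (x 0) g < 0) c.2) s].

(* The graph over the effective domain: F is infinite at x iff no point of the
   form (x, r) with r : R belongs to it. *)
Definition graph_ereal (R : realType) (n : nat) (F : 'rV[R]_n -> \bar R) :
    set 'rV[R]_(n + 1) :=
  [set v | F (lsubmx v) = (rsubmx v 0 0)%:E].

Definition semialgebraic_fun (R : realType) (n : nat) (F : 'rV[R]_n -> \bar R) :
    Prop :=
  semialgebraic_set (graph_ereal F).

(* The values y 0 and z 0 are unconstrained: y^t and z^t are generated for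
   t >= 1 only, and x 0 is the initial point. *)
Definition DR_sequence (R : realType) (n : nat) (f : 'rV[R]_n -> R)
    (g : 'rV[R]_n -> \bar R) (gamma : R) (x0 : 'rV[R]_n)
    (y z x : nat -> 'rV[R]_n) : Prop :=
  x 0%N = x0 /\
  forall t : nat,
    [/\ argmin (fun u => f u + (2 * gamma)^-1 * enorm (u - x t) ^+ 2) (y t.+1),
        argmin (fun u => (g u +
          ((2 * gamma)^-1 * enorm (2 *: y t.+1 - x t - u) ^+ 2)%:E)%E) (z t.+1)
      & x t.+1 = x t + (z t.+1 - y t.+1)].

(* Main.v *)
Require Import Defs.
From HB Require Import structures.
From mathcomp Require Import all_boot all_order all_algebra.
From mathcomp Require Import all_classical all_reals all_analysis.
From mathcomp Require Import ring lra.
From mathcomp Require mpoly.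
From mathcomp Require ordered_qelim polyrcf qe_rcf.

Set Implicit Arguments.
Unset Strict Implicit.
Unset Printing Implicit Defensive.

Import Order.TTheory GRing.Theory Num.Theory.
Import numFieldNormedType.Exports.

Local Open Scope classical_set_scope.
Local Open Scope ring_scope.

(** The proof replaces subdifferential calculus by inequalities that hold
    globally. Write y, z for the two iterates and p = grad f y. Optimality of y
    for a function which is convex after adding a multiple of the squared norm,
    and optimality of z for its proximal problem, give quadratic lower bounds
    of f at y and of g at z, valid at every point ([argmin_proxsubf],
    [argmin_proxsubg]). The merit function
    D(y, z, p) = f y + g z + |z - y|^2 / (2 gamma) + <z - y, p>
    then has two properties. Along the iteration it decreases by at least
    K |dy|^2 ([merit_descent]). Between any two points w, w' satisfying these
    lower bounds, D w' - D w is at most C (|z' - y'| d + d^2), where d is their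
    distance ([merit_gap_le]); thus |z' - y'| plays the role of a slope, and it
    is at most a constant times the next step |dy| ([ZY_step]).

    The semialgebraic hypothesis yields a Kurdyka-Lojasiewicz inequality. The
    level sets of D, restricted to a ball and to the points satisfying the
    lower bounds, form a semialgebraic family of compact sets. By quantifier
    elimination one can select, semialgebraically in the level s, a point of
    smallest slope at that level ([definable_selection]). Its coordinates are
    semialgebraic functions of one real variable, and those are monotone near 0
    ([semifun_eventually_monotone]): the germ at 0 of a semialgebraic set of
    reals is either full or empty, and a function all of whose points are
    strict local minima would contradict uncountability. Monotone coordinates
    give the selected curve a finite length V. Cutting it into small pieces and
    using the second property of D shows that b - a <= C r (V b - V a) for
    levels a < b and any point of level b with slope r ([desingularization]).

    Combining this with the decrease of D, each step |dy| is bounded by a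
    multiple of V s_t - V s_(t+1), where s_t is the current level, as long as y
    stays near the cluster point. These differences telescope, so an iterate
    close enough to the cluster point with s_t small enough never leaves its
    neighbourhood ([finite_length_convergence]). Hence y converges, and so do z
    and x because z - y tends to 0 and grad f is continuous. *)

(** * Polynomial functions and semialgebraic sets *)

(** Coordinates attaining every list of [cdim] reals; they need not separate
    points, since only surjectivity matters for quantifiers. Contexts of free variables are then plain
    products such as [R * 'rV[R]_n], and a quantifier over a point can be
    traded for a block of quantifiers over reals. *)
Structure cspace (R : realType) := CSpace {
  csort :> Type;
  cdim : nat;
  coords : csort -> seq R;
  cpoint : seq R -> csort;
  size_coords : forall x, size (coords x) = cdim;
  cpointK : forall s, size s = cdim -> coords (cpoint s) = s }.

Section CSpaceInstances.
Variable R : realType.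

Definition real_coords (x : R) : seq R := [:: x].
Definition real_cpoint (s : seq R) : R := s`_0.

Lemma real_cpointK s : size s = 1 -> real_coords (real_cpoint s) = s.
Proof. by case: s => [|a [|b s]]. Qed.

Canonical real_cspace : cspace R :=
  @CSpace R R 1 real_coords real_cpoint (fun=> erefl) real_cpointK.

Variable n : nat.

Definition row_coords (v : 'rV[R]_n) : seq R := [seq v 0 i | i <- enum 'I_n].
Definition row_cpoint (s : seq R) : 'rV[R]_n := \row_i s`_i.

Lemma size_row_coords v : size (row_coords v) = n.
Proof. by rewrite size_map size_enum_ord. Qed.

Lemma nth_row_coords v (i : 'I_n) : (row_coords v)`_i = v 0 i.
Proof.
by rewrite (nth_map i) ?size_enum_ord // nth_ord_enum.
Qed.

Lemma row_cpointK s : size s = n -> row_coords (row_cpoint s) = s.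
Proof.
move=> sn; apply: (@eq_from_nth _ 0); first by rewrite size_row_coords sn.
rewrite size_row_coords => i i_n.
by rewrite -[i]/(nat_of_ord (Ordinal i_n)) nth_row_coords mxE.
Qed.

Canonical row_cspace : cspace R :=
  CSpace size_row_coords row_cpointK.

Variables X Y : cspace R.

Definition prod_coords (p : X * Y) : seq R := coords p.1 ++ coords p.2.
Definition prod_cpoint (s : seq R) : X * Y :=
  (cpoint X (take (cdim X) s), cpoint Y (drop (cdim X) s)).

Lemma size_prod_coords p : size (prod_coords p) = (cdim X + cdim Y)%N.
Proof. by rewrite size_cat !size_coords. Qed.

Lemma prod_cpointK s :
  size s = (cdim X + cdim Y)%N -> prod_coords (prod_cpoint s) = s.
Proof.
move=> sXY; rewrite /prod_coords !cpointK ?cat_take_drop //.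
  by rewrite size_drop sXY addKn.
by rewrite size_takel // sXY leq_addr.
Qed.

Canonical prod_cspace : cspace R :=
  CSpace size_prod_coords prod_cpointK.

End CSpaceInstances.

Section Semialgebraic.
Variable R : realType.
Implicit Types X Y Z : cspace R.

Inductive polyfun X : (X -> R) -> Prop :=
| polyfun_cst c : polyfun (fun=> c)
| polyfun_coord i : polyfun (fun x => (coords x)`_i)
| polyfunD p q : polyfun p -> polyfun q -> polyfun (fun x => p x + q x)
| polyfunM p q : polyfun p -> polyfun q -> polyfun (fun x => p x * q x).

(** The Boolean algebra generated by polynomial strict inequalities. Stability
    under substitution of polynomial maps is immediate by induction on this
    presentation, whereas stability under projection is a theorem. *)
Inductive semialg X : set X -> Prop :=
| semialg_gt0 p : polyfun p -> semialg [set x | 0 < p x]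
| semialgI A B : semialg A -> semialg B -> semialg (A `&` B)
| semialgC A : semialg A -> semialg (~` A).

(** Indices beyond the dimension read the default coordinate 0, so quantifying
    over all of nat spares bound conditions. *)
Definition polymap X Y (F : X -> Y) :=
  forall i, polyfun (fun x => (coords (F x))`_i).

Lemma eq_polyfun X (p q : X -> R) : p =1 q -> polyfun q -> polyfun p.
Proof. by move=> /funext ->. Qed.

Lemma eq_semialg X (A B : set X) :
  (forall x, A x <-> B x) -> semialg B -> semialg A.
Proof. by move=> AB; suff -> : A = B by []; apply/seteqP; split=> x /AB. Qed.

Lemma polyfunN X (p : X -> R) : polyfun p -> polyfun (fun x => - p x).
Proof.
move=> pp; apply: (eq_polyfun (fun x => esym (mulN1r (p x)))).
by apply: polyfunM => //; exact: polyfun_cst.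
Qed.

Lemma polyfunB X (p q : X -> R) :
  polyfun p -> polyfun q -> polyfun (fun x => p x - q x).
Proof. by move=> pp pq; apply: polyfunD => //; exact: polyfunN. Qed.

Lemma polyfunX X (p : X -> R) k : polyfun p -> polyfun (fun x => p x ^+ k).
Proof.
move=> pp; elim: k => [|k IH].
  by apply: (eq_polyfun (fun x => expr0 (p x))); exact: polyfun_cst.
by apply: (eq_polyfun (fun x => exprS (p x) k)); exact: polyfunM.
Qed.

Lemma polyfun_sum X (I : Type) (s : seq I) (P : pred I) (p : I -> X -> R) :
  (forall i, polyfun (p i)) -> polyfun (fun x => \sum_(i <- s | P i) p i x).
Proof.
move=> pp; elim: s => [|i s IH].
  by apply: (eq_polyfun (fun x => big_nil _ _ _ _)); exact: polyfun_cst.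
apply: (eq_polyfun (fun x => big_cons _ _ _ _ _ _)).
by case: (P i) => //; exact: polyfunD.
Qed.

Lemma polyfun_prod X (I : Type) (s : seq I) (P : pred I) (p : I -> X -> R) :
  (forall i, polyfun (p i)) -> polyfun (fun x => \prod_(i <- s | P i) p i x).
Proof.
move=> pp; elim: s => [|i s IH].
  by apply: (eq_polyfun (fun x => big_nil _ _ _ _)); exact: polyfun_cst.
apply: (eq_polyfun (fun x => big_cons _ _ _ _ _ _)).
by case: (P i) => //; exact: polyfunM.
Qed.

Lemma polymap_real X (p : X -> R) : polymap p <-> polyfun p.
Proof.
split=> [pp|pp [//|i]]; first exact: (pp 0).
by apply: (@eq_polyfun _ _ (fun=> 0)) => [x|]; [rewrite /= nth_nil|exact: polyfun_cst].
Qed.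

Lemma polymap_polyfun X (p : X -> R) : polymap p -> polyfun p.
Proof. by move/polymap_real. Qed.

Lemma polymap_fst X Y Z (F : X -> Y * Z) :
  polymap F -> polymap (fun x => (F x).1).
Proof.
move=> pF i; have [iY|Yi] := ltnP i (cdim Y).
  apply: eq_polyfun (pF i) => x.
  by rewrite /= /prod_coords nth_cat size_coords iY.
apply: (@eq_polyfun _ _ (fun=> 0)) => [x|]; last exact: polyfun_cst.
by rewrite nth_default // size_coords.
Qed.

Lemma polymap_snd X Y Z (F : X -> Y * Z) :
  polymap F -> polymap (fun x => (F x).2).
Proof.
move=> pF i; apply: eq_polyfun (pF (cdim Y + i)%N) => x.
by rewrite /= /prod_coords nth_cat size_coords ltnNge leq_addr addKn.
Qed.

Lemma polymap_pair X Y Z (F : X -> Y) (G : X -> Z) :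
  polymap F -> polymap G -> polymap (fun x => (F x, G x)).
Proof.
move=> pF pG i; rewrite /= /prod_coords; have [iY|Yi] := ltnP i (cdim Y).
  by apply: eq_polyfun (pF i) => x; rewrite /= nth_cat size_coords iY.
apply: eq_polyfun (pG (i - cdim Y)%N) => x.
by rewrite /= nth_cat size_coords ltnNge Yi.
Qed.

Lemma polymap_id X : polymap (fun x : X => x).
Proof. by move=> i; exact: polyfun_coord. Qed.

Lemma polymap_cst X Y (y : Y) : polymap (fun _ : X => y).
Proof. by move=> i; exact: polyfun_cst. Qed.

Lemma polyfun_row X n (F : X -> 'rV[R]_n) (i : 'I_n) :
  polymap F -> polyfun (fun x => F x 0 i).
Proof.
by move=> pF; apply: eq_polyfun (pF i) => x; rewrite /= nth_row_coords.
Qed.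

Lemma polymap_row X n (F : X -> 'rV[R]_n) :
  (forall i, polyfun (fun x => F x 0 i)) -> polymap F.
Proof.
move=> pF i; have [i_n|n_i] := ltnP i n.
  apply: eq_polyfun (pF (Ordinal i_n)) => x.
  exact: (nth_row_coords (F x) (Ordinal i_n)).
apply: (@eq_polyfun _ _ (fun=> 0)) => [x|]; last exact: polyfun_cst.
by rewrite nth_default // size_coords.
Qed.

Lemma polyfun_comp X Y (F : X -> Y) (p : Y -> R) :
  polymap F -> polyfun p -> polyfun (p \o F).
Proof.
move=> pF; elim=> [c|i|q r _ IHq _ IHr|q r _ IHq _ IHr].
- exact: polyfun_cst.
- exact: pF.
- exact: polyfunD.
- exact: polyfunM.
Qed.

Lemma semialg_preimage X Y (F : X -> Y) (A : set Y) :
  polymap F -> semialg A -> semialg [set x | A (F x)].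
Proof.
move=> pF; elim=> [p pp|B C _ IHB _ IHC|B _ IHB].
- exact: semialg_gt0 (polyfun_comp pF pp).
- exact: semialgI IHB IHC.
- exact: semialgC IHB.
Qed.

Lemma semialg_not X (P : X -> Prop) : semialg P -> semialg (fun x => ~ P x).
Proof. exact: semialgC. Qed.

Lemma semialg_and X (P Q : X -> Prop) :
  semialg P -> semialg Q -> semialg (fun x => P x /\ Q x).
Proof. exact: semialgI. Qed.

Lemma semialg_or X (P Q : X -> Prop) :
  semialg P -> semialg Q -> semialg (fun x => P x \/ Q x).
Proof.
move=> sP sQ; apply: eq_semialg (semialg_not (semialg_and (semialg_not sP)
  (semialg_not sQ))) => x.
by rewrite not_andP !notK.
Qed.

Lemma semialg_imp X (P Q : X -> Prop) :
  semialg P -> semialg Q -> semialg (fun x => P x -> Q x).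
Proof.
move=> sP sQ; apply: eq_semialg (semialg_or (semialg_not sP) sQ) => x.
by rewrite implyE.
Qed.

Lemma semialg_lt X (p q : X -> R) :
  polyfun p -> polyfun q -> semialg (fun x => p x < q x).
Proof.
move=> pp pq; apply: eq_semialg (semialg_gt0 (polyfunB pq pp)) => x /=.
by rewrite subr_gt0.
Qed.

Lemma semialg_le X (p q : X -> R) :
  polyfun p -> polyfun q -> semialg (fun x => p x <= q x).
Proof.
move=> pp pq; apply: eq_semialg (semialg_not (semialg_lt pq pp)) => x /=.
by rewrite leNgt; split => /negP.
Qed.

Lemma semialg_eq X (p q : X -> R) :
  polyfun p -> polyfun q -> semialg (fun x => p x = q x).
Proof.
move=> pp pq; apply: eq_semialg (semialg_and (semialg_le pp pq)
  (semialg_le pq pp)) => x /=.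
by split=> [->//|[pq1 pq2]]; apply/eqP; rewrite eq_le pq1.
Qed.

Lemma semialg_cst X (P : Prop) : semialg (fun _ : X => P).
Proof.
have [p|np] := pselect P.
  by apply: (@eq_semialg _ _ [set x | 0 < (1 : R)]) => [x|];
    [split=> // _; exact: ltr01|apply: semialg_gt0; exact: polyfun_cst].
by apply: (@eq_semialg _ _ [set x | 0 < (0 : R)]) => [x|];
    [rewrite /= ltxx|apply: semialg_gt0; exact: polyfun_cst].
Qed.

(** * Projections of semialgebraic sets *)

Import ordered_qelim.

Definition formula_set X (A : set X) :=
  exists f : ord.formula R, forall x, A x <-> ord.holds (coords x) f.

Lemma polyfun_term X (p : X -> R) : polyfun p ->
  exists t : GRing.term R, forall x, p x = GRing.eval (coords x) t.
Proof.
elim=> [c|i|q r _ [t qt] _ [u ru]|q r _ [t qt] _ [u ru]].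
- by exists (GRing.Const c).
- by exists (GRing.Var _ i).
- by exists (GRing.Add t u) => x /=; rewrite qt ru.
- by exists (GRing.Mul t u) => x /=; rewrite qt ru.
Qed.

Lemma semialg_formula X (A : set X) : semialg A -> formula_set A.
Proof.
elim=> [p /polyfun_term[t pt]|B C _ [f Bf] _ [g Cg]|B _ [f Bf]].
- by exists (ord.Lt (GRing.Const 0) t) => x /=; rewrite pt.
- by exists (ord.And f g) => x /=; rewrite /setI /= Bf Cg.
- by exists (ord.Not f) => x /=; rewrite /setC /= Bf.
Qed.

Lemma rterm_polyfun X (t : GRing.term R) :
  GRing.rterm t -> polyfun (fun x : X => GRing.eval (coords x) t).
Proof.
elim: t => //=.
- by move=> i _; exact: polyfun_coord.
- by move=> c _; exact: polyfun_cst.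
- by move=> k _; exact: polyfun_cst.
- by move=> t IHt u IHu /andP[/IHt pt /IHu pu]; exact: polyfunD.
- by move=> t IHt /IHt pt; exact: polyfunN.
- move=> t IHt k /IHt pt.
  apply: (eq_polyfun (fun x => esym (mulr_natr _ k))).
  by apply: polyfunM => //; exact: polyfun_cst.
- by move=> t IHt u IHu /andP[/IHt pt /IHu pu]; exact: polyfunM.
- by move=> t IHt k /IHt pt; exact: polyfunX.
Qed.

Lemma qf_formula_semialg X (f : ord.formula R) :
  ord.qf_form f -> ord.rformula f ->
  semialg (fun x : X => ord.holds (coords x) f).
Proof.
elim: f => //=.
- by move=> b _ _; exact: semialg_cst.
- by move=> t u _ /andP[/rterm_polyfun pt /rterm_polyfun pu]; exact: semialg_eq.
- by move=> t u _ /andP[/rterm_polyfun pt /rterm_polyfun pu]; exact: semialg_lt.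
- by move=> t u _ /andP[/rterm_polyfun pt /rterm_polyfun pu]; exact: semialg_le.
- move=> f IHf g IHg /andP[qf qg] /andP[rf rg].
  by apply: semialg_and; [exact: IHf|exact: IHg].
- move=> f IHf g IHg /andP[qf qg] /andP[rf rg].
  by apply: semialg_or; [exact: IHf|exact: IHg].
- move=> f IHf g IHg /andP[qf qg] /andP[rf rg].
  by apply: semialg_imp; [exact: IHf|exact: IHg].
- by move=> f IHf qf rf; apply: semialg_not; exact: IHf.
Qed.

(** The Tarski-Seidenberg principle: eliminating the quantifiers of a formula
    leaves polynomial sign conditions on the coordinates. *)
Lemma formula_semialg X (A : set X) : formula_set A -> semialg A.
Proof.
move=> [f Af].
pose g := ord.quantifier_elim
  (fun i s => qe_rcf.qfr_to_formula (@qe_rcf.wproj R i s)) (ord.to_rform f).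
have /andP[qg rg] : ord.qf_form g && ord.rformula g.
  by apply: ord.quantifier_elim_wf (ord.to_rform_rformula f);
    exact: qe_rcf.wf_QE_wproj.
apply: eq_semialg (qf_formula_semialg X qg rg) => x; rewrite Af.
have fg := @qe_rcf.rcf_satP R (coords x) f.
by split=> [/fg /(ord.qf_evalP _ qg)|/(ord.qf_evalP _ qg) /fg].
Qed.

Lemma holds_exists_iota (f : ord.formula R) k (e : seq R) :
  ord.holds e (foldr ord.Exists f (iota (size e) k)) <->
  exists2 s, size s = k & ord.holds (e ++ s) f.
Proof.
elim: k e => [|k IHk] e /=.
  split=> [ef|[s /size0nil ->]]; last by rewrite cats0.
  by exists [::]; rewrite ?cats0.
have set_e r : set_nth 0 e (size e) r = rcons e r.
  by elim: e {IHk} => //= a e ->.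
split=> [[r]|[[//|r s] /= [sk] ef]]; last first.
  by exists r; rewrite set_e -(size_rcons e r); apply/IHk; exists s;
    rewrite ?cat_rcons.
rewrite set_e -(size_rcons e r) => /IHk[s sk ef].
by exists (r :: s); rewrite /= ?sk // -cat_rcons.
Qed.

Lemma semialg_ex X Y (P : X -> Y -> Prop) :
  semialg (fun p : X * Y => P p.1 p.2) -> semialg (fun x => exists y, P x y).
Proof.
move=> /semialg_formula[f Pf]; apply: formula_semialg.
exists (foldr ord.Exists f (iota (cdim X) (cdim Y))) => x.
rewrite -(size_coords x) holds_exists_iota; split=> [[y Pxy]|[s sY xsf]].
  by exists (coords y); [exact: size_coords|exact/(Pf (x, y))].
by exists (cpoint Y s); apply/(Pf (_, _)); rewrite /= /prod_coords cpointK.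
Qed.

Lemma semialg_all X Y (P : X -> Y -> Prop) :
  semialg (fun p : X * Y => P p.1 p.2) -> semialg (fun x => forall y, P x y).
Proof.
move=> /semialg_not sP.
apply: eq_semialg (semialg_not (semialg_ex (P := fun x y => ~ P x y) sP)) => x.
split=> [Px [y]//|nP y]; exact: contra_notP (fun nPy => ex_intro _ y nPy) nP.
Qed.

(** * Functions with a semialgebraic graph *)

Definition semifun X (h : X -> R) := semialg [set p : X * R | h p.1 = p.2].

Lemma polyfun_semifun X (p : X -> R) : polyfun p -> semifun p.
Proof.
move=> pp; apply: semialg_eq; first exact: polyfun_comp (polymap_fst (@polymap_id _)) pp.
exact/polymap_real/polymap_snd/polymap_id.
Qed.

(** Replacing the value h x by a variable bound to lie on the graph of h is a
    projection; this is how non-polynomial functions enter formulas. *)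
Lemma semialg_subst X (h : X -> R) (P : X -> R -> Prop) :
  semifun h -> semialg (fun p : X * R => P p.1 p.2) ->
  semialg (fun x => P x (h x)).
Proof.
move=> sh sP; apply: (@eq_semialg _ _ (fun x => exists r, h x = r /\ P x r)).
  by move=> x; split=> [Px|[r [<-]]//]; exists (h x).
exact/semialg_ex/semialg_and.
Qed.

Lemma semifun_comp X Y (F : X -> Y) (h : Y -> R) :
  polymap F -> semifun h -> semifun (h \o F).
Proof.
move=> pF sh; apply: (@semialg_preimage _ _ (fun p : X * R => (F p.1, p.2)) _ _ sh).
apply: polymap_pair; last exact/polymap_snd/polymap_id.
by move=> i; exact: polyfun_comp (polymap_fst (@polymap_id _)) (pF i).
Qed.

Lemma semialg_subst2 X (u v : X -> R) (Q : X -> R -> R -> Prop) :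
  semifun u -> semifun v -> semialg (fun q : X * R * R => Q q.1.1 q.1.2 q.2) ->
  semialg (fun x => Q x (u x) (v x)).
Proof.
move=> su sv sQ; apply: (semialg_subst (P := fun x r => Q x r (v x)) su).
apply: (semialg_subst (P := fun (p : X * R) r => Q p.1 p.2 r)) => //.
exact: semifun_comp (polymap_fst (@polymap_id _)) sv.
Qed.

Lemma semialg_ltf X (u v : X -> R) :
  semifun u -> semifun v -> semialg (fun x => u x < v x).
Proof.
move=> su sv; apply: (semialg_subst2 (Q := fun _ r s => r < s) su sv).
by apply: semialg_lt; apply/polymap_real/polymap_snd => //;
  exact/polymap_fst/polymap_id || exact/polymap_id.
Qed.

Lemma semialg_lef X (u v : X -> R) :
  semifun u -> semifun v -> semialg (fun x => u x <= v x).
Proof.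
move=> su sv; apply: eq_semialg (semialg_not (semialg_ltf sv su)) => x.
by rewrite leNgt; split => /negP.
Qed.

Lemma semifunD X (u v : X -> R) :
  semifun u -> semifun v -> semifun (fun x => u x + v x).
Proof.
move=> su sv.
apply: (semialg_subst2 (X := (X * R)%type) (u := u \o fst) (v := v \o fst)
  (Q := fun p r s => r + s = p.2)); [exact: semifun_comp (polymap_fst (@polymap_id _)) _..|].
apply: semialg_eq; first apply: polyfunD.
- exact/polymap_real/polymap_snd/polymap_fst/polymap_id.
- exact/polymap_real/polymap_snd/polymap_id.
- exact/polymap_real/polymap_snd/polymap_fst/polymap_fst/polymap_id.
Qed.

Lemma semifunN X (u : X -> R) : semifun u -> semifun (fun x => - u x).
Proof.
move=> su.
have pN : polymap (fun p : X * R => (p.1, - p.2)).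
  apply: polymap_pair; first exact/polymap_fst/polymap_id.
  exact/polymap_real/polyfunN/polymap_real/polymap_snd/polymap_id.
by apply: eq_semialg (semialg_preimage pN su) => p /=; split=> [<-|->];
  rewrite opprK.
Qed.

End Semialgebraic.

(** * Germs at zero and the monotonicity theorem *)

Section Germs.
Variable R : realType.
Implicit Types (A : set R) (h : R -> R).

Lemma near0_rightP A : (\forall e \near 0^'+, A e) <->
  exists d : R, 0 < d /\ forall e, 0 < e /\ e < d -> A e.
Proof.
split=> [/nbhs_ballP[d /= d0 Ad]|[d [d0 Ad]]].
  exists d; split=> // e [e0 ed]; apply: Ad => //=.
  by rewrite /ball /= sub0r normrN gtr0_norm.
near=> e; apply: Ad; split; first by near: e; exact: nbhs_right_gt.
by near: e; exact: nbhs_right_lt.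
Unshelve. all: by end_near. Qed.

Lemma polyfun_horner (p : R -> R) :
  polyfun p -> exists q : {poly R}, forall x, p x = q.[x].
Proof.
elim=> [c|[|i]|f g _ [q fq] _ [r gr]|f g _ [q fq] _ [r gr]].
- by exists c%:P => x; rewrite hornerC.
- by exists 'X => x; rewrite hornerX.
- by exists 0 => x; rewrite horner0 /= nth_nil.
- by exists (q + r) => x; rewrite hornerD fq gr.
- by exists (q * r) => x; rewrite hornerM fq gr.
Qed.

(** A nonzero polynomial has a constant sign before its first positive root. *)
Lemma semialg_germ A : semialg A ->
  (\forall e \near 0^'+, A e) \/ (\forall e \near 0^'+, ~ A e).
Proof.
elim=> [p /polyfun_horner[q pq]|B C _ [nB|nB] _ [nC|nC]|B _ [nB|nB]];
  [|left|right|right|right|right|left]; last 6 first.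
- by near=> e; split; near: e.
- by near=> e => -[_]; near: e.
- by near=> e => -[+ _]; near: e.
- by near=> e => -[+ _]; near: e.
- by near=> e => /(_ _); apply; near: e.
- by near=> e; near: e.
have [q0|q0] := eqVneq q 0.
  by right; near=> e => /=; rewrite pq q0 horner0 ltxx.
have signq : \forall e \near 0^'+, Num.sg q.[e] = polyrcf.sgp_right q 0.
  have q_gt0 := polyrcf.next_root_gt (@ltr01 R) q0.
  near=> e; apply: (@polyrcf.sgr_neighpr _ 1); rewrite in_itv /=.
  by apply/andP; split; near: e; [exact: nbhs_right_gt|exact: nbhs_right_lt].
have [sq|sq] := boolP (polyrcf.sgp_right q 0 == 1); [left|right].
  near=> e; rewrite /= pq -sgr_gt0 (_ : Num.sg _ = polyrcf.sgp_right q 0);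
    last by near: e.
  by rewrite (eqP sq) ltr01.
near=> e => /=; rewrite pq -sgr_cp0 (_ : Num.sg _ = polyrcf.sgp_right q 0).
  exact/negP.
by near: e.
Unshelve. all: by end_near. Qed.

Lemma near0_pos_ex A : (\forall e \near 0^'+, A e) -> exists2 e, 0 < e & A e.
Proof.
move=> nA; have pf := at_right_proper_filter (0 : R).
have /filter_ex[e [e0 Ae]] : \forall e \near 0^'+, 0 < e /\ A e.
  by near=> e; split; near: e; [exact: nbhs_right_gt|].
by exists e.
Unshelve. all: by end_near. Qed.

(** The supremum of the points of ]a, b] related to a is itself related to a,
    by a left step, and cannot lie strictly below b, by a right step. *)
Lemma local_to_global (T : R -> R -> Prop) (a b : R) :
  a < b -> (forall x y z, T x y -> T y z -> T x z) ->
  (forall c, a <= c <= b -> \forall e \near 0^'+, a <= c - e -> T (c - e) c) ->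
  (forall c, a <= c <= b -> \forall e \near 0^'+, c + e <= b -> T c (c + e)) ->
  T a b.
Proof.
move=> ab Ttr Tl Tr; pose S := [set x | a < x <= b /\ T a x].
have S0 : S !=set0.
  have /near0_pos_ex[e e0 [aeb Te]] :
      \forall e \near 0^'+, a + e <= b /\ (a + e <= b -> T a (a + e)).
    near=> e; split; last by near: e; apply: Tr; rewrite lexx ltW.
    by rewrite -lerBrDl ltW//; near: e; apply: nbhs_right_lt; rewrite subr_gt0.
  by exists (a + e); split; [rewrite ltrDl e0|exact: Te].
have Sb : ubound S b by move=> x [/andP[]].
have Ssup : has_sup S by split=> //; exists b.
have [x0 Sx0] := S0; have /andP[ax0 x0b] := Sx0.1.
set c := sup S; have cb : c <= b by exact: ge_sup.
have ac : a < c by rewrite (lt_le_trans ax0)//; exact: sup_upper_bound.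
have acb : a <= c <= b by rewrite (ltW ac).
have Tac : T a c.
  have /near0_rightP[d [d0 Td]] := Tl _ acb.
  have [x Sx cdx] := sup_adherent d0 Ssup.
  have := sup_upper_bound Ssup Sx; rewrite le_eqVlt => /predU1P[xc|xc].
    by rewrite /c -xc; exact: Sx.2.
  apply: Ttr Sx.2 _; rewrite -(subKr c x); apply: Td.
    by split; [rewrite subr_gt0|rewrite ltrBlDr -ltrBlDl].
  by rewrite subKr; case: Sx => /andP[/ltW].
move: cb; rewrite le_eqVlt => /predU1P[<-//|cb].
have /near0_pos_ex[e e0 [ceb /(_ ceb) Te]] :
    \forall e \near 0^'+, c + e <= b /\ (c + e <= b -> T c (c + e)).
  near=> e; split; last by near: e; exact: Tr.
  by rewrite -lerBrDl ltW//; near: e; apply: nbhs_right_lt; rewrite subr_gt0.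
have /(sup_upper_bound Ssup) : S (c + e).
  by split; [rewrite ceb ltr_wpDr// ltW|exact: Ttr Tac Te].
by rewrite -/c gerDl leNgt e0.
Unshelve. all: by end_near. Qed.

(** Two points that are strictly minimal within a fixed radius are at least that
    far apart, so there are countably many of them, while an interval is
    uncountable. *)
Lemma no_interval_strict_min h d : 0 < d ->
  ~ (forall a, 0 < a < d ->
       \forall e \near 0^'+, h a < h (a + e) /\ h a < h (a - e)).
Proof.
move=> d0 hmin.
pose A k := [set a | 0 < a < d /\
  forall s, a != s -> `|s - a| < k.+1%:R^-1 -> h a < h s].
have cA k : countable (A k).
  apply/countable_injP; exists (fun a => Num.trunc (a * k.+1%:R)) => a b.
  rewrite !inE => -[/andP[a0 _] Aa] [/andP[b0 _] Ab] ab.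
  apply/eqP/negPn/negP => nab.
  have k0 : 0 < k.+1%:R :> R by rewrite ltr0n.
  have dist : `|b - a| < k.+1%:R^-1.
    rewrite -[ltRHS]mul1r ltr_pdivlMr// -(gtr0_norm k0) -normrM.
    have /truncn_itv/andP[] : 0 <= a * k.+1%:R by rewrite mulr_ge0// ltW.
    have /truncn_itv/andP[] : 0 <= b * k.+1%:R by rewrite mulr_ge0// ltW.
    rewrite ab -!natr1 ltr_norml mulrBl => ? ? ? ?; lra.
  have := Ab a; rewrite eq_sym distrC => /(_ nab dist).
  by apply/negP; rewrite -leNgt ltW// Aa.
have cover : `]0, d[%classic `<=` \bigcup_k A k.
  move=> a /=; rewrite in_itv /= => ad.
  have /near0_rightP[r [r0 hr]] := hmin _ ad.
  exists (Num.trunc r^-1) => //; split=> // s nas dist.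
  have {dist} sr : `|s - a| < r.
    rewrite (lt_trans dist)// invf_plt ?posrE ?ltr0n//.
    exact: truncnS_gt.
  have [sa|sa|sa] := ltgtP s a; last by rewrite sa eqxx in nas.
    have [] := hr (a - s); last by rewrite subKr.
    by rewrite subr_gt0 sa -(gtr0_norm (_ : 0 < a - s)) ?subr_gt0// distrC.
  have [] := hr (s - a); last by rewrite addrC subrK.
  by rewrite subr_gt0 sa -(gtr0_norm (_ : 0 < s - a)) ?subr_gt0.
have /countable_lebesgue_measure0 : countable `]0, d[%classic.
  apply: (sub_countable (subset_card_le cover)).
  exact: bigcup_countable.
rewrite lebesgue_measure_itv /= lte_fin d0 oppr0 adde0 => -[d_eq0].
by rewrite d_eq0 ltxx in d0.
Qed.

(** The dichotomy of semialgebraic germs, applied to the two strict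
    comparisons. *)
Lemma germ_trichotomy (u v : R -> R) : semifun u -> semifun v ->
  [\/ \forall e \near 0^'+, u e < v e, \forall e \near 0^'+, v e < u e |
      \forall e \near 0^'+, u e = v e].
Proof.
move=> su sv; have [uv|nuv] := semialg_germ (semialg_ltf su sv).
  by constructor 1.
have [vu|nvu] := semialg_germ (semialg_ltf sv su); first by constructor 2.
constructor 3; near=> e; apply/eqP; rewrite eq_le !leNgt.
by apply/andP; split; apply/negP; near: e.
Unshelve. all: by end_near. Qed.

Section Monotonicity.
Variable h : R -> R.
Hypothesis sh : semifun h.

Lemma polymap_step (s : R) : polymap (fun p : R * R => p.1 + s * p.2).
Proof.
apply/polymap_real/polyfunD; first exact/polymap_real/polymap_fst/polymap_id.
by apply: polyfunM; [exact: polyfun_cst|exact/polymap_real/polymap_snd/polymap_id].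
Qed.

Lemma semialg_near (P : R -> R -> Prop) :
  semialg (fun p : R * R => P p.1 p.2) ->
  semialg (fun a => \forall e \near 0^'+, P a e).
Proof.
move=> sP; apply: (eq_semialg (fun a => near0_rightP (P a))).
apply: semialg_ex; apply: semialg_and.
  by apply: semialg_lt; [exact: polyfun_cst|exact/polymap_real/polymap_snd/polymap_id].
apply: semialg_all; apply: semialg_imp.
  apply: semialg_and; apply: semialg_lt.
  - exact: polyfun_cst.
  - exact/polymap_real/polymap_snd/polymap_id.
  - exact/polymap_real/polymap_snd/polymap_id.
  - exact/polymap_real/polymap_snd/polymap_fst/polymap_id.
apply: (semialg_preimage (F := fun q : R * R * R => (q.1.1, q.2)) _ sP).
by apply: polymap_pair; [exact/polymap_fst/polymap_fst/polymap_id
                        |exact/polymap_snd/polymap_id].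
Qed.

(** For s = 1 and s = -1 this describes how h moves just to the right and just
    to the left of a point. The behaviour is the same at all points close to 0
    because the set of points showing a given one is itself semialgebraic. *)
Lemma step_trichotomy (s : R) : exists2 d, 0 < d &
  [\/ forall a, 0 < a < d -> \forall e \near 0^'+, h a < h (a + s * e),
      forall a, 0 < a < d -> \forall e \near 0^'+, h (a + s * e) < h a |
      forall a, 0 < a < d -> \forall e \near 0^'+, h (a + s * e) = h a].
Proof.
have sh1 : semifun (fun p : R * R => h p.1).
  exact: semifun_comp (polymap_fst (@polymap_id _ _)) sh.
have sh2 : semifun (fun p : R * R => h (p.1 + s * p.2)).
  exact: (semifun_comp (F := fun p : R * R => p.1 + s * p.2) (polymap_step s) sh).
have conclude (P : R -> R -> Prop) :
    (\forall a \near 0^'+, \forall e \near 0^'+, P a e) ->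
    exists2 d, 0 < d & forall a, 0 < a < d -> \forall e \near 0^'+, P a e.
  move=> /near0_rightP[d [d0 Pd]]; exists d => // a /andP[a0 ad].
  by apply: Pd.
have [up|nup] := semialg_germ (semialg_near (P := fun a e => h a < h (a + s * e))
    (semialg_ltf sh1 sh2)).
  by have [d d0 hd] := conclude _ up; exists d => //; constructor 1.
have [dn|ndn] := semialg_germ (semialg_near (P := fun a e => h (a + s * e) < h a)
    (semialg_ltf sh2 sh1)).
  by have [d d0 hd] := conclude _ dn; exists d => //; constructor 2.
have [d d0 hd] : exists2 d, 0 < d & forall a, 0 < a < d ->
    \forall e \near 0^'+, h (a + s * e) = h a.
  apply: (conclude (fun a e => h (a + s * e) = h a)); near=> a.
  have hcst : semifun (fun _ : R => h a) by apply/polyfun_semifun/polyfun_cst.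
  have pa : polymap (fun e : R => a + s * e).
    apply/polymap_real/polyfunD; first exact: polyfun_cst.
    by apply: polyfunM; [exact: polyfun_cst|exact/polymap_real/polymap_id].
  have [lt|lt|//] := germ_trichotomy (semifun_comp pa sh) hcst.
    by exfalso; move: lt; near: a.
  by exfalso; move: lt; near: a.
by exists d => //; constructor 3.
Unshelve. all: by end_near. Qed.

(** Inside an interval on which h is constant, it is constant on both sides of
    each point. *)
Lemma no_one_sided_constancy (s d : R) : `|s| = 1 -> 0 < d ->
  (forall a, 0 < a < d -> \forall e \near 0^'+, h (a + s * e) = h a) ->
  ~ (forall a, 0 < a < d -> \forall e \near 0^'+, h (a - s * e) <> h a).
Proof.
move=> s1 d0 hs hNs; pose a := d / 2.
have ad : 0 < a < d by rewrite /a; lra.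
have /near0_rightP[r [r0 hr]] := hs _ ad.
have [e0 e00 [e0r e0a]] : exists2 e0, 0 < e0 & e0 < r /\ e0 < a.
  apply: near0_pos_ex; near=> e; split; near: e; apply: nbhs_right_lt => //.
  by case/andP: ad.
have cd : 0 < a + s * e0 < d.
  have : `|s * e0| < a by rewrite normrM s1 mul1r gtr0_norm.
  by rewrite ltr_norml => /andP[]; rewrite /a => ? ?; lra.
have /near0_pos_ex[e e_gt0 [ee0 neq]] : \forall e \near 0^'+,
    e < e0 /\ h (a + s * e0 - s * e) <> h (a + s * e0).
  by near=> e; split; near: e; [exact: nbhs_right_lt|exact: hNs].
apply: neq; rewrite -addrA -mulrBr !hr //; split; lra.
Unshelve. all: by end_near. Qed.

(** The left and right behaviours near 0 combine into nine cases. Those with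
    exactly one equality contradict [no_one_sided_constancy], those making all
    points strict local extrema contradict [no_interval_strict_min], and the
    three others propagate from germs to an interval. *)
Theorem semifun_eventually_monotone : exists2 d, 0 < d &
  [\/ {in `]0, d[ &, {homo h : a b / a < b}},
      {in `]0, d[ &, {homo h : a b / a < b >-> b < a}} |
      {in `]0, d[ &, forall a b, h a = h b}].
Proof.
have [dr dr0 Hr] := step_trichotomy 1; have [dl dl0 Hl] := step_trichotomy (-1).
pose d := Num.min dr dl; have d0 : 0 < d by rewrite lt_min dr0.
exists d => //.
have inr a : 0 < a < d -> 0 < a < dr by rewrite lt_min => /and3P[-> ->].
have inl a : 0 < a < d -> 0 < a < dl by rewrite lt_min => /and3P[-> _ ->].
have globalize (T : R -> R -> Prop) :
    (forall x y z, T x y -> T y z -> T x z) ->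
    (forall a, 0 < a < d -> \forall e \near 0^'+, T (a + -1 * e) a) ->
    (forall a, 0 < a < d -> \forall e \near 0^'+, T a (a + 1 * e)) ->
    {in `]0, d[ &, forall a b, a < b -> T a b}.
  move=> Ttr TL TR a b; rewrite !in_itv /= => /andP[a0 ad] /andP[b0 bd] ab.
  have cd c : a <= c <= b -> 0 < c < d.
    by move=> /andP[ac cb]; rewrite (lt_le_trans a0)// (le_lt_trans cb).
  apply: (local_to_global ab Ttr) => c /cd cin; near=> e => _.
    by rewrite -[- e]mulN1r; near: e; exact: TL.
  by rewrite -[e]mul1r; near: e; exact: TR.
have globalize_eq :
    (forall a, 0 < a < d -> \forall e \near 0^'+, h (a + -1 * e) = h a) ->
    (forall a, 0 < a < d -> \forall e \near 0^'+, h (a + 1 * e) = h a) ->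
    {in `]0, d[ &, forall a b, h a = h b}.
  move=> TL TR a b ain bin.
  have eqT := globalize (fun a b => h a = h b) (fun x y z => @etrans _ _ _ _) TL.
  have {}eqT : {in `]0, d[ &, forall a b, a < b -> h a = h b}.
    by apply: eqT => c cin; near=> e; apply/esym; near: e; exact: TR.
  by have [ab|ab|->//] := ltgtP a b; [|apply/esym]; exact: eqT.
have no_min (k : R -> R) :
    (forall a, 0 < a < d -> \forall e \near 0^'+, k a < k (a + 1 * e)) ->
    ~ (forall a, 0 < a < d -> \forall e \near 0^'+, k a < k (a + -1 * e)).
  move=> kr kl; apply: (@no_interval_strict_min k d d0) => a ad; near=> e; split.
    by rewrite -[e]mul1r; near: e; exact: kr.
  by rewrite -[- e]mulN1r; near: e; exact: kl.
have neq_of (P : R -> R -> Prop) (s : R) : (forall a e, P a e -> h (a - s * e) <> h a) ->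
    (forall a, 0 < a < d -> \forall e \near 0^'+, P a e) ->
    forall a, 0 < a < d -> \forall e \near 0^'+, h (a - s * e) <> h a.
  by move=> PN HP a ad; near=> e; apply: PN; near: e; exact: HP.
have lt_neq (x y : R) : x < y -> x <> y by move=> /[swap] ->; rewrite ltxx.
have norm1 : `|1| = 1 :> R by rewrite normr1.
have normN1 : `|-1| = 1 :> R by rewrite normrN1.
case: Hr => Hr; case: Hl => Hl.
- exfalso; apply: (no_min h) => a ad; [exact: Hr (inr _ ad)|exact: Hl (inl _ ad)].
- constructor 1 => a b ain bin ab.
  by apply: (globalize (fun a b => h a < h b)) => //;
    [move=> x y z; exact: lt_trans|move=> c /inl; exact: Hl|move=> c /inr; exact: Hr].
- exfalso; apply: (no_one_sided_constancy normN1 d0) => [a /inl|]; first exact: Hl.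
  apply: (neq_of (fun a e => h a < h (a + 1 * e))) => [a e|a /inr]; last exact: Hr.
  by rewrite mulN1r mul1r opprK => /lt_neq/nesym.
- constructor 2 => a b ain bin ab.
  by apply: (globalize (fun a b => h b < h a)) => //;
    [move=> x y z xy yz; exact: lt_trans yz xy|move=> c /inl; exact: Hl|
     move=> c /inr; exact: Hr].
- exfalso; apply: (no_min (fun a => - h a)) => a ad; near=> e; rewrite ltrN2; near: e.
    exact: Hr (inr _ ad).
  exact: Hl (inl _ ad).
- exfalso; apply: (no_one_sided_constancy normN1 d0) => [a /inl|]; first exact: Hl.
  apply: (neq_of (fun a e => h (a + 1 * e) < h a)) => [a e|a /inr]; last exact: Hr.
  by rewrite mulN1r mul1r opprK => /lt_neq.
- exfalso; apply: (no_one_sided_constancy norm1 d0) => [a /inr|]; first exact: Hr.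
  apply: (neq_of (fun a e => h a < h (a + -1 * e))) => [a e|a /inl]; last exact: Hl.
  by rewrite mulN1r mul1r => /lt_neq/nesym.
- exfalso; apply: (no_one_sided_constancy norm1 d0) => [a /inr|]; first exact: Hr.
  apply: (neq_of (fun a e => h (a + -1 * e) < h a)) => [a e|a /inl]; last exact: Hl.
  by rewrite mulN1r mul1r => /lt_neq.
- by constructor 3; apply: globalize_eq => a; [move=> /inl; exact: Hl|move=> /inr; exact: Hr].
Unshelve. all: by end_near. Qed.

End Monotonicity.
End Germs.

(** * Desingularization along a semialgebraic selection *)

Section Desingularization.
Variables (R : realType) (N : nat).
Implicit Types A B : R -> set 'rV[R]_N.

Lemma polyfun_continuous (p : 'rV[R]_N -> R) : polyfun p -> continuous p.
Proof.
elim=> [c|i|q r _ cq _ cr|q r _ cq _ cr] x.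
- exact: cst_continuous.
- have [iN|Ni] := ltnP i N; last first.
    rewrite (_ : (fun y : 'rV[R]_N => _) = fun=> 0); first exact: cst_continuous.
    by apply/funext => y; rewrite nth_default // size_coords.
  rewrite (_ : (fun y : 'rV[R]_N => _) = fun y => y 0 (Ordinal iN)).
    exact: coord_continuous.
  by apply/funext => y; rewrite (nth_row_coords y (Ordinal iN)).
- exact: cvgD (cq x) (cr x).
- exact: cvgM (cq x) (cr x).
Qed.

Definition minimizers A (c : 'rV[R]_N -> R) : R -> set 'rV[R]_N :=
  fun s => [set w | A s w /\ forall w', A s w' -> c w <= c w'].

Definition semialg_family A := semialg [set p : R * 'rV[R]_N | A p.1 p.2].

Lemma semialg_minimizers A c : semialg_family A -> polyfun c ->
  semialg_family (minimizers A c).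
Proof.
move=> sA pc; apply: semialg_and => //; apply: semialg_all; apply: semialg_imp.
  apply: (semialg_preimage (F := fun q : R * 'rV[R]_N * 'rV[R]_N => (q.1.1, q.2)) _ sA).
  by apply: polymap_pair; [exact/polymap_fst/polymap_fst/polymap_id
                          |exact/polymap_snd/polymap_id].
apply: semialg_le; apply: (polyfun_comp _ pc).
  exact/polymap_snd/polymap_fst/polymap_id.
exact/polymap_snd/polymap_id.
Qed.

Lemma minimizers_nonempty A c s : polyfun c -> compact (A s) ->
  A s !=set0 -> minimizers A c s !=set0.
Proof.
move=> /polyfun_continuous cc cA A0.
have [w /[!inE] Aw wmin] := compact_EVT_min A0 cA (continuous_subspaceT cc).
by exists w; split=> // w' Aw'; apply: wmin; rewrite inE.
Qed.

Lemma compact_minimizers A c s : polyfun c -> compact (A s) ->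
  compact (minimizers A c s).
Proof.
move=> /polyfun_continuous cc cA.
rewrite (_ : minimizers A c s =
  A s `&` \bigcap_(w' in A s) [set w | c w <= c w']); last first.
  by apply/seteqP; split=> w [].
apply: compact_closedI => //; apply: closed_bigI => w' _.
exact: ((continuous_closedP c).1 cc _ (@closed_le _ (c w'))).
Qed.

(** Minimizing c0 and then each coordinate in turn leaves a single point in
    each fibre: compactness keeps the successive sets of minimizers nonempty,
    and quantifier elimination keeps them semialgebraic. *)
Lemma definable_selection A (c0 : 'rV[R]_N -> R) :
  semialg_family A -> (forall s, compact (A s)) -> polyfun c0 ->
  exists B, [/\ semialg_family B, forall s, B s `<=` minimizers A c0 s,
    forall s, A s !=set0 -> B s !=set0 &
    forall s w w', B s w -> B s w' -> w = w'].
Proof.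
move=> sA cA pc0.
have [B [sB _ BA B0 Bu]] : exists B, [/\ semialg_family B,
    forall s, compact (B s), forall s, B s `<=` minimizers A c0 s,
    forall s, A s !=set0 -> B s !=set0 &
    forall i, i \in enum 'I_N -> forall s w w', B s w -> B s w' -> w 0 i = w' 0 i].
  elim: (enum 'I_N) => [|i l [B [sB cB BA B0 Bu]]].
    exists (minimizers A c0); split=> //; first exact: semialg_minimizers.
    - by move=> s; exact: compact_minimizers.
    - by move=> s w.
    by move=> s As; exact: minimizers_nonempty.
  have pi : polyfun (fun w : 'rV[R]_N => w 0 i) by apply/polyfun_row/polymap_id.
  exists (minimizers B (fun w => w 0 i)); split.
  - exact: semialg_minimizers.
  - by move=> s; exact: compact_minimizers.
  - by move=> s w [/BA].
  - by move=> s /B0 Bs; exact: minimizers_nonempty.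
  - move=> j; rewrite inE => /predU1P[->|jl] s w w' [Bw wmin] [Bw' wmin'].
      by apply/eqP; rewrite eq_le wmin // wmin'.
    exact: Bu jl _ _ _ Bw Bw'.
exists B; split=> // s w w' Bw Bw'; apply/rowP => i.
by apply: Bu Bw Bw'; rewrite mem_enum.
Qed.

(** The value 0 outside ]0, eps[ makes the function total while keeping its
    graph semialgebraic. *)
Lemma semifun_selection B (w : R -> 'rV[R]_N) (c : 'rV[R]_N -> R) (eps : R) :
  semialg_family B -> polyfun c -> (forall s x x', B s x -> B s x' -> x = x') ->
  (forall s, 0 < s < eps -> B s (w s)) ->
  semifun (fun s : R => if 0 < s < eps then c (w s) else 0).
Proof.
move=> sB pc Bu Bw; pose I := [set p : R * R | 0 < p.1 /\ p.1 < eps].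
have sI : semialg I.
  by apply: semialg_and; apply: semialg_lt; (exact: polyfun_cst) ||
    exact/polymap_real/polymap_fst/polymap_id.
apply: (@eq_semialg _ _ _ (fun p => (I p /\ exists x, B p.1 x /\ c x = p.2) \/
    (~ I p /\ p.2 = 0))); last first.
  apply: semialg_or; apply: semialg_and => //.
  - apply: semialg_ex; apply: semialg_and.
      apply: (semialg_preimage (F := fun q : R * R * 'rV[R]_N => (q.1.1, q.2)) _ sB).
      by apply: polymap_pair; [exact/polymap_fst/polymap_fst/polymap_id
                              |exact/polymap_snd/polymap_id].
    apply: semialg_eq; first exact: polyfun_comp (polymap_snd (@polymap_id _ _)) pc.
    exact/polymap_real/polymap_snd/polymap_fst/polymap_id.
  - exact: semialg_not.
  - by apply: semialg_eq; [exact/polymap_real/polymap_snd/polymap_id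
                          |exact: polyfun_cst].
move=> [s r] /=; rewrite /I /=; case: ifPn => sE.
  have [s0 seps] := andP sE; split=> [<-|[[_ [x [Bx <-]]]|[[]]]//].
    by left; split=> //; exists (w s); split=> //; exact: Bw.
  by rewrite (Bu _ _ _ Bx (Bw _ sE)).
split=> [<-|[[[s0 seps]]|[_ ->]]//]; last by rewrite s0 seps in sE.
by right; split=> // -[s0 seps]; rewrite s0 seps in sE.
Qed.

(** One sign per function lets sums of absolute increments telescope. *)
Lemma semifun_orientation (h : R -> R) : semifun h -> exists sigma : R,
  `|sigma| = 1 /\ \forall d \near 0^'+,
    forall a b, 0 < a -> a <= b -> b < d -> sigma * h a <= sigma * h b.
Proof.
move=> /semifun_eventually_monotone[d d0 mono].
have inE a : 0 < a -> a < d -> a \in `]0, d[ by rewrite in_itv /= => -> ->.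
have near_le (P : R -> Prop) : (forall e, e <= d -> P e) -> \forall e \near 0^'+, P e.
  by move=> HP; near=> e; apply: HP; near: e; exact: nbhs_right_le.
case: mono => mono.
- exists 1; split; first exact: normr1.
  apply: near_le => e ed a b a0; rewrite le_eqVlt => /predU1P[->//|ab] be.
  have bd := lt_le_trans be ed; rewrite !mul1r ltW // mono // inE //.
    exact: lt_trans bd.
  exact: lt_trans ab.
- exists (-1); split; first exact: normrN1.
  apply: near_le => e ed a b a0; rewrite le_eqVlt => /predU1P[->//|ab] be.
  have bd := lt_le_trans be ed; rewrite !mulN1r lerN2 ltW // mono // inE //.
    exact: lt_trans bd.
  exact: lt_trans ab.
- exists 1; split; first exact: normr1.
  apply: near_le => e ed a b a0 ab be.
  have bd := lt_le_trans be ed; rewrite (mono a b) // inE //.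
    exact: le_lt_trans bd.
  exact: lt_le_trans ab.
Unshelve. all: by end_near. Qed.

Definition l1dist (v w : 'rV[R]_N) := \sum_(i < N) `|v 0 i - w 0 i|.

Lemma l1dist_ge0 v w : 0 <= l1dist v w.
Proof. exact: sumr_ge0. Qed.

(** The Kurdyka-Lojasiewicz inequality in integrated form. The family A stands
    for the level sets of a function, indexed by its value, rho for a squared
    slope, and V for the desingularizing function. Choose at each level s a
    point W s of smallest slope. Its coordinates are semialgebraic functions of
    s, hence monotone near 0, and V is the sum of the coordinates, signed so as
    to be nondecreasing: V measures the length of the curve W. The hypothesis
    relating levels and distances bounds an increase of level by the slope
    times the length travelled, up to a quadratic error which disappears when
    the curve is cut into small pieces. Any other point of the same level has a
    larger slope. *)
Theorem desingularization A (rho : 'rV[R]_N -> R) (eps M C : R) :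
  semialg_family A -> (forall s, compact (A s)) -> polyfun rho ->
  (forall w, 0 <= rho w) -> 0 < eps -> 0 < C ->
  (forall s, 0 < s < eps -> A s !=set0) ->
  (forall s w i, A s w -> `|w 0 i| <= M) ->
  (forall a b v w, 0 < a -> a < b -> A a v -> A b w ->
     b - a <= C * (Num.sqrt (rho w) * l1dist w v + l1dist w v ^+ 2)) ->
  (forall eta d, 0 < eta -> 0 < d ->
     exists s w, [/\ 0 < s < d, A s w & rho w < eta]) ->
  exists d (V : R -> R) m, [/\ 0 < d, forall s, 0 < s < d -> m <= V s,
    forall a b, 0 < a -> a < b -> b < d -> V a <= V b &
    forall a b w, 0 < a -> a < b -> b < d -> A b w ->
      b - a <= C * Num.sqrt (rho w) * (V b - V a)].
Proof.
move=> sA cA prho rho0 eps0 C0 A0 AM Adist Asmall.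
have [B [sB BA B0 Bu]] := definable_selection sA cA prho.
have [W BW] : exists W : R -> 'rV[R]_N, forall s, 0 < s < eps -> B s (W s).
  have ex s : exists w, 0 < s < eps -> B s w.
    have [sE|_] := boolP (0 < s < eps); last by exists 0.
    by have [w Bw] := B0 s (A0 s sE); exists w.
  by have [W BW] := choice ex; exists W.
have AW s : 0 < s < eps -> A s (W s) by move=> /BW /BA[].
pose h c s := if 0 < s < eps then c (W s) else 0 : R.
have sh c : polyfun c -> semifun (h c).
  by move=> pc; exact: semifun_selection sB pc Bu BW.
have [tau [tau1 tauP]] := semifun_orientation (sh _ prho).
have /choice[sigma sigmaP] i :=
  semifun_orientation (sh (fun w => w 0 i) (polyfun_row i (@polymap_id _ _))).
have /filter_forall nsigma i := (sigmaP i).2.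
have pf := at_right_proper_filter (0 : R).
have /filter_ex[d [d0 deps dtau dsigma]] : \forall d \near 0^'+, [/\ 0 < d, d < eps,
    forall a b, 0 < a -> a <= b -> b < d -> tau * h rho a <= tau * h rho b &
    forall i a b, 0 < a -> a <= b -> b < d ->
      sigma i * h (fun w => w 0 i) a <= sigma i * h (fun w => w 0 i) b].
  near=> d; split.
  - by near: d; exact: nbhs_right_gt.
  - by near: d; exact: nbhs_right_lt.
  - by near: d.
  - by near: d; exact: nsigma.
have dE s : 0 < s -> s < d -> 0 < s < eps by move=> -> /lt_trans ->.
have hE c s : 0 < s -> s < d -> h c s = c (W s).
  by move=> s0 sd; rewrite /h dE.
pose V s := \sum_(i < N) sigma i * h (fun w => w 0 i) s.
have VE a b : 0 < a -> a <= b -> b < d -> V b - V a = l1dist (W b) (W a).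
  move=> a0 ab bd; rewrite /V -sumrB; apply: eq_bigr => i _.
  have ad := le_lt_trans ab bd; have b0 := lt_le_trans a0 ab.
  have := dsigma i a b a0 ab bd; rewrite -subr_ge0 => /ger0_norm.
  by rewrite -mulrBr normrM (sigmaP i).1 mul1r !hE // => <-.
have rho_mono a b : 0 < a -> a <= b -> b < d -> rho (W a) <= rho (W b).
  (* were it not, the smallest slope would grow as the level decreases to 0,
     contrary to the existence of points of arbitrarily small slope there *)
  have [tauE|tauE] : tau = 1 \/ tau = -1.
    have [t0|t0] := leP 0 tau; [left|right].
      by rewrite -tau1 ger0_norm.
    by rewrite -tau1 ltr0_norm // opprK.
  - move=> a0 ab bd; have := dtau a b a0 ab bd; rewrite tauE !mul1r !hE //.
      exact: lt_le_trans ab.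
    exact: le_lt_trans bd.
  have anti a' b' : 0 < a' -> a' <= b' -> b' < d -> rho (W b') <= rho (W a').
    move=> a0 ab bd; have := dtau a' b' a0 ab bd; rewrite tauE !mulN1r lerN2 !hE //.
      exact: le_lt_trans bd.
    exact: lt_le_trans ab.
  have zero s : 0 < s -> s < d -> rho (W s) = 0.
    move=> s0 sd; apply/eqP; rewrite eq_le rho0 andbT leNgt; apply/negP => /Asmall.
    move=> /(_ _ s0)[r [w [/andP[r0 rs] Arw]]]; apply/negP; rewrite -leNgt.
    rewrite (le_trans (anti r s r0 (ltW rs) sd)) //.
    by have [_] := BA _ _ (BW r (dE r r0 (lt_trans rs sd))); apply.
  move=> a0 ab bd; rewrite !zero //.
    exact: lt_le_trans ab.
  exact: le_lt_trans bd.
exists d, V, (- \sum_(i < N) M); split=> // [s /andP[s0 sd]|a b a0 ab bd|a b w a0 ab bd Abw].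
  rewrite /V -sumrN; apply: ler_sum => i _.
  have : `|sigma i * h (fun w => w 0 i) s| <= M.
    by rewrite normrM (sigmaP i).1 mul1r hE //; apply: AM (AW s (dE s s0 sd)).
  by rewrite ler_norml => /andP[].
  by rewrite -subr_ge0 (VE a b a0 (ltW ab) bd) l1dist_ge0.
have b0 := lt_trans a0 ab.
suff key eta : 0 < eta ->
    b - a <= C * (Num.sqrt (rho (W b)) + eta) * (V b - V a).
  have Vab : 0 <= V b - V a.
    by rewrite (VE a b a0 (ltW ab) bd) l1dist_ge0.
  have rhobw : Num.sqrt (rho (W b)) <= Num.sqrt (rho w).
    by apply: ler_wsqrtr; have [_] := BA _ _ (BW b (dE b b0 bd)); apply.
  apply: (@le_trans _ _ (C * Num.sqrt (rho (W b)) * (V b - V a))); last first.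
    by rewrite ler_wpM2r // ler_wpM2l // ltW.
  apply/ler_addgt0Pr => e e0.
  move: (V b - V a) (Num.sqrt (rho (W b))) Vab key => D r D0 key.
  have D1 : 0 < D + 1 by rewrite ltr_wpDl.
  apply: le_trans (key (e / (C * (D + 1))) _) _.
    by rewrite divr_gt0 // mulr_gt0.
  rewrite (_ : C * _ * D = C * r * D + e * (D / (D + 1))); last first.
    by field; rewrite !gt_eqF.
  by rewrite lerD2l ler_piMr ?(ltW e0) // ler_pdivrMr // mul1r lerDl.
(* a step crossing a jump of V is harmless: V gains at least eta over it,
   while the levels of its two ends are within C * eta ^+ 2 of each other *)
move=> eta0; have step c e : 0 < c -> 0 < e -> c + e <= b -> e < C * eta ^+ 2 ->
    e <= C * (Num.sqrt (rho (W b)) + eta) * (V (c + e) - V c).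
  move=> c0 e0 ceb esmall.
  have ce : c < c + e by rewrite ltrDl.
  have ced := le_lt_trans ceb bd.
  have := Adist c (c + e) (W c) (W (c + e)) c0 ce (AW _ (dE _ c0 (lt_trans ce ced)))
    (AW _ (dE _ (lt_trans c0 ce) ced)).
  rewrite -(VE c) ?(ltW ce) // addrC addKr => est.
  have slope : Num.sqrt (rho (W (c + e))) <= Num.sqrt (rho (W b)).
    by apply: ler_wsqrtr; apply: rho_mono => //; exact: lt_trans ce.
  have DV0 : 0 <= V (c + e) - V c by rewrite (VE c (c + e) c0 (ltW ce) ced) l1dist_ge0.
  move: est slope DV0 (sqrtr_ge0 (rho (W b))).
  set D := V (c + e) - V c; set r := Num.sqrt _; set r' := Num.sqrt _.
  move=> est slope DV0 r'0.
  have [Deta|etaD] := leP D eta.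
    apply: (le_trans est); rewrite -mulrA ler_pM2l //.
    by rewrite mulrDl lerD // ?ler_wpM2r // expr2 ler_wpM2r.
  apply: (le_trans (ltW esmall)); rewrite -mulrA ler_pM2l // expr2.
  by apply: ler_pM; rewrite ?(ltW eta0) // ?(ltW etaD) // ler_wpDl.
have Ceta : 0 < C * eta ^+ 2 by rewrite mulr_gt0 // exprn_gt0.
pose T x y : Prop := y - x <= C * (Num.sqrt (rho (W b)) + eta) * (V y - V x).
apply: (@local_to_global _ T _ _ ab).
- by move=> x y z; rewrite /T !mulrBr => xy yz; lra.
- move=> c /andP[ac cb]; near=> e => ace.
  have := step (c - e) e; rewrite subrK /T subKr; apply.
  + exact: lt_le_trans ace.
  + by near: e; exact: nbhs_right_gt.
  + exact: cb.
  + by near: e; exact: nbhs_right_lt.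
- move=> c /andP[ac cb]; near=> e => ceb.
  have := step c e; rewrite /T [c + e - c]addrAC subrr add0r; apply.
  + exact: lt_le_trans ac.
  + by near: e; exact: nbhs_right_gt.
  + exact: ceb.
  + by near: e; exact: nbhs_right_lt.
Unshelve. all: by end_near. Qed.

End Desingularization.

(** * Euclidean inner product *)

Section Euclid.
Variables (R : realType) (n : nat).
Implicit Types u v w y z p : 'rV[R]_n.

Definition dot u v := \sum_(i < n) u 0 i * v 0 i.

Lemma dot_ge0 u : 0 <= dot u u.
Proof. by apply: sumr_ge0 => i _; rewrite -expr2 sqr_ge0. Qed.

Lemma enorm_ge0 u : 0 <= enorm u.
Proof. exact: sqrtr_ge0. Qed.

Lemma enormE u : enorm u = Num.sqrt (dot u u).
Proof. by congr Num.sqrt; apply: eq_bigr => i _; rewrite expr2. Qed.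

Lemma sqr_enorm u : enorm u ^+ 2 = dot u u.
Proof. by rewrite enormE sqr_sqrtr ?dot_ge0. Qed.

Lemma coord_le_enorm u i : `|u 0 i| <= enorm u.
Proof.
rewrite -sqrtr_sqr; apply: ler_wsqrtr.
by rewrite (bigD1 i) //= lerDl sumr_ge0 // => j _; rewrite sqr_ge0.
Qed.

Lemma enorm0 : enorm (0 : 'rV[R]_n) = 0.
Proof.
rewrite enormE (_ : dot 0 0 = 0) ?sqrtr0 //.
by apply: big1 => i _; rewrite mxE mul0r.
Qed.

Lemma enorm_eq0 u : enorm u = 0 -> u = 0.
Proof.
move=> u0; apply/rowP => i; apply/eqP; rewrite mxE -normr_eq0 eq_le normr_ge0.
by rewrite -u0 coord_le_enorm.
Qed.

Lemma enormN u : enorm (- u) = enorm u.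
Proof. by congr Num.sqrt; apply: eq_bigr => i _; rewrite mxE sqrrN. Qed.

Lemma enormZ (a : R) u : enorm (a *: u) = `|a| * enorm u.
Proof.
rewrite -sqrtr_sqr -sqrtrM ?sqr_ge0 //; congr Num.sqrt.
by rewrite mulr_sumr; apply: eq_bigr => i _; rewrite mxE exprMn.
Qed.

Lemma sqr_enormD u v :
  enorm (u + v) ^+ 2 = enorm u ^+ 2 + 2 * dot u v + enorm v ^+ 2.
Proof.
rewrite !sqr_enorm /dot mulr_sumr -!big_split; apply: eq_bigr => i _ /=.
by rewrite !mxE; ring.
Qed.

Lemma dotZr (a : R) u v : dot u (a *: v) = a * dot u v.
Proof. by rewrite /dot mulr_sumr; apply: eq_bigr => i _; rewrite mxE mulrCA. Qed.

Lemma dotNr u v : dot u (- v) = - dot u v.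
Proof. by rewrite -scaleN1r dotZr mulN1r. Qed.

Lemma dot_le u v : dot u v <= enorm u * enorm v.
Proof.
have [/enorm_eq0 ->|v0] := eqVneq (enorm v) 0.
  by rewrite /dot big1 ?enorm0 ?mulr0 // => i _; rewrite mxE mulr0.
have v_gt0 : 0 < enorm v by rewrite lt_def v0 enorm_ge0.
have := sqr_ge0 (enorm (u + (- (dot u v / enorm v ^+ 2)) *: v)).
rewrite sqr_enormD dotZr enormZ exprMn -normrX sqrrN ger0_norm ?sqr_ge0 //.
have -> : enorm u ^+ 2 + 2 * (- (dot u v / enorm v ^+ 2) * dot u v) +
    (dot u v / enorm v ^+ 2) ^+ 2 * enorm v ^+ 2 =
    enorm u ^+ 2 - (dot u v / enorm v) ^+ 2 by field.
rewrite subr_ge0 => le2; rewrite -ler_pdivrMr //.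
have [q0|/ltW q0] := leP 0 (dot u v / enorm v).
  by rewrite -(ler_pXn2r (n := 2)) // nnegrE enorm_ge0.
exact: le_trans q0 (enorm_ge0 u).
Qed.

Lemma enormD u v : enorm (u + v) <= enorm u + enorm v.
Proof.
rewrite -(ler_pXn2r (n := 2)) ?nnegrE ?addr_ge0 ?enorm_ge0 //.
by rewrite sqr_enormD sqrrD lerD2r lerD2l mulr_natl lerMn2r dot_le.
Qed.

Lemma enormB u v : enorm (u - v) <= enorm u + enorm v.
Proof. by rewrite -(enormN v) enormD. Qed.

Lemma enormC u v : enorm (u - v) = enorm (v - u).
Proof. by rewrite -enormN opprB. Qed.

Lemma enorm_split w u v : enorm (u - v) <= enorm (u - w) + enorm (w - v).
Proof. by rewrite -[u - v](subrKA w) enormD. Qed.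

Lemma enorm_le_l1 u : enorm u <= \sum_(i < n) `|u 0 i|.
Proof.
have S0 : 0 <= \sum_(i < n) `|u 0 i| by exact: sumr_ge0.
rewrite -(ler_pXn2r (n := 2)) ?nnegrE ?enorm_ge0 // sqr_enorm expr2 mulr_suml.
apply: ler_sum => i _; rewrite -expr2 -real_normK ?num_real // expr2.
by rewrite ler_wpM2l // (bigD1 i) //= lerDl sumr_ge0.
Qed.

(** * The merit function *)

Section Merit.
Variables (gamma : R).
Hypothesis gamma_gt0 : 0 < gamma.

(** With x = z + gamma p this is the Douglas-Rachford merit function
    f y + g z + (|x - y|^2 - |x - z|^2) / (2 gamma). In the
    variables y, z, p, where p stands for grad f y, its first-order variation
    is controlled by |z - y| alone. *)
Definition merit (fy gz : R) (y z p : 'rV[R]_n) : R :=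
  fy + gz + (2 * gamma)^-1 * enorm (z - y) ^+ 2 + dot (z - y) p.

(** Compare through the subgradient inequalities of f and g at the primed
    point. The terms linear in p' cancel, so every remaining first-order term
    contains the factor z' - y'. *)
Lemma merit_gap l (fy gz : R) y z p (fy' gz' : R) y' z' p' :
  fy' + dot p' (y - y') - l / 2 * enorm (y - y') ^+ 2 <= fy ->
  gz' + dot (gamma^-1 *: (y' - z') - p') (z - z')
    - (2 * gamma)^-1 * enorm (z - z') ^+ 2 <= gz ->
  merit fy' gz' y' z' p' - merit fy gz y z p <=
    dot (z' - y') (p' - p - gamma^-1 *: (y' - y))
    - dot (z' - y' - (z - y)) (p' - p) + l / 2 * enorm (y' - y) ^+ 2
    + (2 * gamma)^-1 * (enorm (z' - z) ^+ 2 - enorm (z' - y' - (z - y)) ^+ 2).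
Proof.
move=> Hf Hg.
have id : dot (z' - y') (p' - p - gamma^-1 *: (y' - y))
    - dot (z' - y' - (z - y)) (p' - p) + l / 2 * dot (y' - y) (y' - y)
    + (2 * gamma)^-1 * dot (z' - z) (z' - z)
    - (2 * gamma)^-1 * dot (z' - y' - (z - y)) (z' - y' - (z - y)) =
    - dot p' (y - y') + l / 2 * dot (y - y') (y - y')
    - dot (gamma^-1 *: (y' - z') - p') (z - z')
    + (2 * gamma)^-1 * dot (z - z') (z - z')
    + (2 * gamma)^-1 * dot (z' - y') (z' - y') + dot (z' - y') p'
    - (2 * gamma)^-1 * dot (z - y) (z - y) - dot (z - y) p.
  rewrite /dot !mulr_sumr -!sumrN -!big_split; apply: eq_bigr => i _ /=.
  by rewrite !mxE; field; rewrite gt_eqF.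
by move: Hf Hg id; rewrite /merit !sqr_enorm; lra.
Qed.

(** Two consecutive iterates have the same x, and this relation turns z' - y'
    into increments of y and p, after which the z terms cancel. *)
Lemma merit_descent l (fy gz : R) y z p (fy' gz' : R) y' z' p' :
  fy' + dot p' (y - y') - l / 2 * enorm (y - y') ^+ 2 <= fy ->
  gz' + dot (gamma^-1 *: (y' - z') - p') (z - z')
    - (2 * gamma)^-1 * enorm (z - z') ^+ 2 <= gz ->
  z + gamma *: p = y' + gamma *: p' ->
  merit fy' gz' y' z' p' - merit fy gz y z p <=
    gamma * enorm (p' - p) ^+ 2
    - ((2 * gamma)^-1 - l / 2) * enorm (y' - y) ^+ 2.
Proof.
move=> Hf Hg H4; have := merit_gap p Hf Hg; rewrite !sqr_enorm => /le_trans; apply.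
have -> : z = y' + gamma *: (p' - p).
  by apply/rowP => i; move/rowP/(_ i): H4; rewrite !mxE; lra.
suff id : dot (z' - y') (p' - p - gamma^-1 *: (y' - y))
    - dot (z' - y' - (y' + gamma *: (p' - p) - y)) (p' - p)
    + l / 2 * dot (y' - y) (y' - y)
    + (2 * gamma)^-1 * dot (z' - (y' + gamma *: (p' - p))) (z' - (y' + gamma *: (p' - p)))
    - (2 * gamma)^-1 * dot (z' - y' - (y' + gamma *: (p' - p) - y))
        (z' - y' - (y' + gamma *: (p' - p) - y)) =
    gamma * dot (p' - p) (p' - p) - (2 * gamma)^-1 * dot (y' - y) (y' - y)
    + l / 2 * dot (y' - y) (y' - y).
  by move: id; lra.
rewrite /dot !mulr_sumr -!sumrN -!big_split; apply: eq_bigr => i _ /=.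
by rewrite !mxE; field; rewrite gt_eqF.
Qed.

Lemma merit_gap_le l (fy gz : R) y z p (fy' gz' : R) y' z' p' (d : R) :
  fy' + dot p' (y - y') - l / 2 * enorm (y - y') ^+ 2 <= fy ->
  gz' + dot (gamma^-1 *: (y' - z') - p') (z - z')
    - (2 * gamma)^-1 * enorm (z - z') ^+ 2 <= gz ->
  enorm (y' - y) + enorm (z' - z) + enorm (p' - p) <= d ->
  merit fy' gz' y' z' p' - merit fy gz y z p <=
    (gamma^-1 + 1 + `|l|) * (enorm (z' - y') * d + d ^+ 2).
Proof.
move=> Hf Hg Hd; apply: le_trans (merit_gap p Hf Hg) _.
have ginv0 : 0 < gamma^-1 by rewrite invr_gt0.
have [y0 z0 p0] := And3 (enorm_ge0 (y' - y)) (enorm_ge0 (z' - z)) (enorm_ge0 (p' - p)).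
have e0 := enorm_ge0 (z' - y').
set e' := z' - y' in e0 *; set de := e' - (z - y).
have d0 : 0 <= d by lra.
have B1 : dot e' (p' - p - gamma^-1 *: (y' - y)) <= (gamma^-1 + 1) * (enorm e' * d).
  apply: le_trans (dot_le _ _) _; rewrite mulrCA ler_wpM2l //.
  apply: le_trans (enormB _ _) _; rewrite enormZ (gtr0_norm ginv0) mulrDl mul1r addrC.
  by apply: lerD; [rewrite ler_pM2l //|]; lra.
have B2 : - dot de (p' - p) <= d ^+ 2.
  have de_d : enorm de <= d.
    have -> : de = z' - z - (y' - y) by rewrite /de /e' !opprB addrACA [RHS]addrACA [- y' + _]addrC.
    by apply: le_trans (enormB _ _) _; lra.
  rewrite -dotNr; apply: le_trans (dot_le _ _) _; rewrite enormN expr2.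
  by apply: ler_pM; rewrite ?enorm_ge0 //; lra.
have B3 : l / 2 * enorm (y' - y) ^+ 2 <= `|l| * d ^+ 2.
  have le2 : enorm (y' - y) ^+ 2 <= d ^+ 2 by rewrite ler_pXn2r ?nnegrE //; lra.
  have l_le := ler_norm l; have l0 := normr_ge0 l.
  apply: (@le_trans _ _ (`|l| * enorm (y' - y) ^+ 2)); last by rewrite ler_wpM2l.
  by rewrite ler_wpM2r ?sqr_ge0 //; lra.
have B4 : (2 * gamma)^-1 * (enorm (z' - z) ^+ 2 - enorm de ^+ 2) <= gamma^-1 * d ^+ 2.
  have le2 : enorm (z' - z) ^+ 2 <= d ^+ 2 by rewrite ler_pXn2r ?nnegrE //; lra.
  have de2 := sqr_ge0 (enorm de); have z2 := sqr_ge0 (enorm (z' - z)).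
  rewrite (_ : (2 * gamma)^-1 = gamma^-1 * 2^-1) -?mulrA ?ler_pM2l //; last first.
    by rewrite invfM mulrC.
  by lra.
have ed0 : 0 <= enorm e' * d by rewrite mulr_ge0.
have led0 : 0 <= `|l| * (enorm e' * d) by rewrite mulr_ge0.
rewrite -/de; move: B1 B2 B3 B4 led0; lra.
Qed.

End Merit.
End Euclid.

(** * Semialgebraic sets given by lists of polynomials *)

Section PolynomialLists.
Variable R : realType.

Lemma polyfun_meval m (h : mpoly.mpoly m R) :
  polyfun (fun x : 'rV[R]_m => mpoly.meval (x 0) h).
Proof.
apply: (eq_polyfun (fun x : 'rV[R]_m => mpoly.mevalE (x 0) h)).
apply: polyfun_sum => mm; apply: polyfunM; first exact: polyfun_cst.
by apply: polyfun_prod => i; apply/polyfunX/polyfun_row/polymap_id.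
Qed.

Lemma semialgebraic_set_semialg m (S : set 'rV[R]_m) :
  semialgebraic_set S -> semialg S.
Proof.
move=> [s ->] {S}; elim: s => [|[hs gs] s IH]; first exact: (semialg_cst _ false).
pose vanish := [set x : 'rV[R]_m | all (fun h => mpoly.meval (x 0) h == 0) hs].
pose neg := [set x : 'rV[R]_m | all (fun g => mpoly.meval (x 0) g < 0) gs].
have svanish : semialg vanish.
  rewrite /vanish; elim: hs {vanish} => [|h hs IHs]; first exact: (semialg_cst _ true).
  apply: eq_semialg (semialg_and (semialg_eq (polyfun_meval h) (polyfun_cst _ 0)) IHs) => x /=.
  by split=> [/andP[/eqP]|[/eqP -> ->]].
have sneg : semialg neg.
  rewrite /neg; elim: gs {neg} => [|g gs IHs]; first exact: (semialg_cst _ true).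
  apply: eq_semialg (semialg_and (semialg_lt (polyfun_meval g) (polyfun_cst _ 0)) IHs) => x /=.
  by split=> /andP.
apply: eq_semialg (semialg_or (semialg_and svanish sneg) IH) => x /=.
by split=> [/orP[/andP|]|[/andP ->|->]]; rewrite ?orbT; [left|right|..].
Qed.

Lemma semialgebraic_fun_graph n (F : 'rV[R]_n -> \bar R) :
  semialgebraic_fun F -> semialg [set p : 'rV[R]_n * R | F p.1 = p.2%:E].
Proof.
move=> /semialgebraic_set_semialg sF.
have pj : polymap (fun p : 'rV[R]_n * R => row_mx p.1 (const_mx p.2 : 'rV[R]_1)).
  apply: polymap_row => i; case: (split_ordP i) => j ->.
    apply: (eq_polyfun (fun p => row_mxEl _ _ _ _)).
    exact/polyfun_row/polymap_fst/polymap_id.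
  apply: (eq_polyfun (fun p => row_mxEr _ _ _ _)).
  apply: (@eq_polyfun _ _ _ (fun p => p.2)) => [p|]; first by rewrite mxE.
  exact/polymap_real/polymap_snd/polymap_id.
apply: eq_semialg (semialg_preimage pj sF) => p.
by rewrite /graph_ereal /= row_mxKl row_mxKr mxE.
Qed.

Lemma semialgebraic_semifun n (f : 'rV[R]_n -> R) :
  semialgebraic_fun (EFin \o f) -> semifun f.
Proof.
move=> /semialgebraic_fun_graph; apply: eq_semialg => p /=.
by split=> [->|[]].
Qed.

End PolynomialLists.

Section VectorPolymaps.
Variables (R : realType) (X : cspace R).

Lemma polymap_lsubmx m n (F : X -> 'rV[R]_(m + n)) :
  polymap F -> polymap (fun x => lsubmx (F x)).
Proof.
move=> pF; apply: polymap_row => i.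
by apply: (eq_polyfun (q := fun x => F x 0 (lshift n i))) => [x|];
  [rewrite mxE|exact: polyfun_row].
Qed.

Lemma polymap_rsubmx m n (F : X -> 'rV[R]_(m + n)) :
  polymap F -> polymap (fun x => rsubmx (F x)).
Proof.
move=> pF; apply: polymap_row => i.
by apply: (eq_polyfun (q := fun x => F x 0 (rshift m i))) => [x|];
  [rewrite mxE|exact: polyfun_row].
Qed.

Variable n : nat.
Implicit Types F G : X -> 'rV[R]_n.

Lemma polymapB F G : polymap F -> polymap G -> polymap (fun x => F x - G x).
Proof.
move=> pF pG; apply: polymap_row => i.
apply: (eq_polyfun (q := fun x => F x 0 i - G x 0 i)) => [x|]; first by rewrite !mxE.
by apply: polyfunB; exact: polyfun_row.
Qed.

Lemma polymapZ (a : R) F : polymap F -> polymap (fun x => a *: F x).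
Proof.
move=> pF; apply: polymap_row => i.
apply: (eq_polyfun (q := fun x => a * F x 0 i)) => [x|]; first by rewrite !mxE.
by apply: polyfunM; [exact: polyfun_cst|exact: polyfun_row].
Qed.

Lemma polyfun_dot F G : polymap F -> polymap G -> polyfun (fun x => dot (F x) (G x)).
Proof.
by move=> pF pG; apply: polyfun_sum => i; apply: polyfunM; exact: polyfun_row.
Qed.

Lemma polyfun_sqr_enorm F : polymap F -> polyfun (fun x => enorm (F x) ^+ 2).
Proof.
by move=> pF; apply: (eq_polyfun (fun x => sqr_enorm (F x))); exact: polyfun_dot.
Qed.

End VectorPolymaps.

Ltac poly_tac := repeat first
  [ assumption | exact: polymap_id | exact: polyfun_cst | exact: polymap_cst
  | apply: polymapB | apply: polymapZ | apply: polymap_lsubmx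
  | apply: polymap_rsubmx | apply: polymap_fst | apply: polymap_snd
  | apply: polymap_pair
  | apply: polyfun_sqr_enorm | apply: polyfun_dot
  | apply: polyfunD | apply: polyfunN | apply: polyfunM
  | apply: polymap_polyfun ].

(** * Level sets of the merit function *)

Section LevelSets.
Variables (R : realType) (n : nat) (f : 'rV[R]_n -> R) (g : 'rV[R]_n -> \bar R).
Variables (l gamma : R).
Hypothesis gamma_gt0 : 0 < gamma.

Definition ypart (w : 'rV[R]_(n + (n + n))) : 'rV[R]_n := lsubmx w.
Definition zpart (w : 'rV[R]_(n + (n + n))) : 'rV[R]_n := lsubmx (rsubmx w).
Definition ppart (w : 'rV[R]_(n + (n + n))) : 'rV[R]_n := rsubmx (rsubmx w).

(** The subgradients below satisfy their quadratic lower bounds at every u, with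
    one curvature constant, so that two points of a level set can be compared
    at any distance and no limiting subdifferential is involved. *)
Definition proxsubf (y p : 'rV[R]_n) :=
  forall u, f y + dot p (u - y) - l / 2 * enorm (u - y) ^+ 2 <= f u.

Definition proxsubg (gz : R) (z q : 'rV[R]_n) :=
  forall u, ((gz + dot q (u - z) - (2 * gamma)^-1 * enorm (u - z) ^+ 2)%:E <= g u)%E.

(** The value that g must take at the z part for the merit function to equal
    D + s. Prescribing it removes g from the other conditions, where it is
    only lower semicontinuous. *)
Definition gvalue (D s : R) (w : 'rV[R]_(n + (n + n))) : R :=
  D + s - f (ypart w) - (2 * gamma)^-1 * enorm (zpart w - ypart w) ^+ 2
  - dot (zpart w - ypart w) (ppart w).

Definition level_set (D M s : R) : set 'rV[R]_(n + (n + n)) :=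
  [set w | (dot w w <= M /\ proxsubf (ypart w) (ppart w)) /\
    (g (zpart w) = (gvalue D s w)%:E /\
     proxsubg (gvalue D s w) (zpart w) (gamma^-1 *: (ypart w - zpart w) - ppart w))].

Lemma semialg_level_set D M : (forall u, (-oo < g u)%E) ->
  semifun f -> semialg [set p : 'rV[R]_n * R | g p.1 = p.2%:E] ->
  semialg_family (level_set D M).
Proof.
move=> gNy sf sg.
have fF (X : cspace R) (F : X -> 'rV[R]_n) : polymap F -> semifun (fun x => f (F x)).
  by move=> pF; exact: semifun_comp pF sf.
have sgv (X : cspace R) (S : X -> R) (F : X -> 'rV[R]_(n + (n + n))) :
    polyfun S -> polymap F -> semifun (fun x => gvalue D (S x) (F x)).
  move=> pS pF; rewrite /gvalue /ypart /zpart /ppart.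
  apply: semifunD; last by apply: polyfun_semifun; poly_tac.
  apply: semifunD; last by apply: polyfun_semifun; poly_tac.
  apply: semifunD; first by apply: polyfun_semifun; poly_tac.
  by apply: semifunN; apply: fF; poly_tac.
apply: semialg_and; apply: semialg_and.
- by apply: semialg_le; poly_tac.
- rewrite /proxsubf /ypart /ppart; apply: semialg_all; apply: semialg_lef.
    apply: semifunD; last by apply: polyfun_semifun; poly_tac.
    by apply: semifunD; [apply: fF|apply: polyfun_semifun]; poly_tac.
  by apply: fF; poly_tac.
- apply: (semialg_subst (h := fun p => gvalue D p.1 p.2)
    (P := fun p r => g (zpart p.2) = r%:E)); first by apply: sgv; poly_tac.
  apply: (semialg_preimage (F := fun q : R * 'rV[R]_(n + (n + n)) * R =>
    (zpart q.1.2, q.2)) _ sg).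
  by rewrite /zpart; poly_tac.
- apply: (eq_semialg (B := fun p => forall u r, g u = r%:E ->
    gvalue D p.1 p.2 + dot (gamma^-1 *: (ypart p.2 - zpart p.2) - ppart p.2) (u - zpart p.2)
    - (2 * gamma)^-1 * enorm (u - zpart p.2) ^+ 2 <= r)).
    move=> p; split=> [Hp u r gu|Hp u].
      by rewrite -lee_fin -gu; exact: Hp.
    have := gNy u; case gu: (g u) => [r||]// _; last exact: leey.
    by rewrite lee_fin; exact: Hp.
  rewrite /ypart /zpart /ppart.
  apply: semialg_all; apply: semialg_all; apply: semialg_imp.
    apply: (semialg_preimage (F := fun q : R * 'rV[R]_(n + (n + n)) * 'rV[R]_n * R =>
      (q.1.2, q.2)) _ sg).
    by poly_tac.
  apply: semialg_lef; last by apply: polyfun_semifun; poly_tac.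
  apply: semifunD; last by apply: polyfun_semifun; poly_tac.
  by apply: semifunD; [apply: sgv|apply: polyfun_semifun]; poly_tac.
Qed.

Lemma closed_le_cont (T : topologicalType) (phi : T -> R) (c : R) :
  continuous phi -> closed [set x | phi x <= c].
Proof. by move=> cphi; exact: ((continuous_closedP phi).1 cphi _ (@closed_le _ c)). Qed.

Lemma closed_lsc_le (T : topologicalType) (phi : T -> R) (zeta : T -> 'rV[R]_n) :
  lower_semicontinuous g -> continuous phi -> continuous zeta ->
  closed [set x | (g (zeta x) <= (phi x)%:E)%E].
Proof.
move=> glsc cphi czeta; rewrite -[X in closed X]setCK; apply: open_closedC.
rewrite openE => x /= /negP; rewrite -ltNge => lt_phi_g.
have [a phia ag] : exists2 a, phi x < a & (a%:E < g (zeta x))%E.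
  move: lt_phi_g; case: (g (zeta x)) => [r||]//; rewrite ?lte_fin => phir.
    by exists ((phi x + r) / 2); rewrite ?lte_fin; lra.
  by exists (phi x + 1); rewrite ?ltry // ltrDl.
have [V nV Vg] := glsc _ _ ag.
have nphi : \forall x' \near x, phi x' < a by exact: (cvgr_lt _ (cphi x)).
have nzeta : \forall x' \near x, V (zeta x') by exact: czeta nV.
rewrite /interior; near=> x'; apply/negP; rewrite -ltNge.
apply: lt_trans (Vg _ _); last by near: x'.
by rewrite lte_fin; near: x'.
Unshelve. all: by end_near. Qed.

(** The subgradient inequality of g at u = z already gives one half of the
    equation g z = gvalue; the other half is closed by lower semicontinuity. *)
Lemma compact_level_set D M s : continuous f -> lower_semicontinuous g ->
  (forall u, (-oo < g u)%E) -> compact (level_set D M s).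
Proof.
move=> cf glsc gNy.
have cy : continuous ypart by exact: continuous_lsubmx.
have cz : continuous zpart.
  move=> w; apply: (continuous_comp (g := lsubmx)); first exact: continuous_rsubmx.
  exact: continuous_lsubmx.
have cfy : continuous (f \o ypart) by move=> w; apply: continuous_comp; [exact: cy|exact: cf].
have cpoly (q : 'rV[R]_(n + (n + n)) -> R) : polyfun q -> continuous q.
  exact: polyfun_continuous.
have cgv : continuous (gvalue D s).
  pose q w := D + s - (2 * gamma)^-1 * enorm (zpart w - ypart w) ^+ 2
      - dot (zpart w - ypart w) (ppart w).
  have cq : continuous q by apply: cpoly; rewrite /q /zpart /ypart /ppart; poly_tac.
  have -> : gvalue D s = fun w => q w - (f \o ypart) w.
    by apply/funext => w; rewrite /gvalue /q /=; ring.
  by move=> w; exact: cvgB (cq w) (cfy w).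
pose box := [set w : 'rV[R]_(n + (n + n)) |
  forall i, `[- Num.sqrt M, Num.sqrt M]%classic (w ord0 i)].
have cbox : compact box.
  exact: (@rV_compact _ _ (fun=> `[- Num.sqrt M, Num.sqrt M]%classic)
    (fun=> @segment_compact _ _ _)).
pose K := [set w | dot w w <= M] `&`
  (\bigcap_(u : 'rV[R]_n) [set w | (f \o ypart) w +
     (dot (ppart w) (u - ypart w) - l / 2 * enorm (u - ypart w) ^+ 2) <= f u]) `&`
  [set w | (g (zpart w) <= (gvalue D s w)%:E)%E] `&`
  (\bigcap_(u : 'rV[R]_n) [set w | ((gvalue D s w +
     (dot (gamma^-1 *: (ypart w - zpart w) - ppart w) (u - zpart w)
     - (2 * gamma)^-1 * enorm (u - zpart w) ^+ 2))%:E <= g u)%E]).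
have -> : level_set D M s = box `&` K.
  apply/seteqP; split=> w.
    move=> [[wM wf] [gz wg]]; split.
      move=> i /=; rewrite in_itv /= -ler_norml (le_trans (coord_le_enorm w i)) //.
      by rewrite enormE ler_wsqrtr.
    split; [split; [split=> //|]|].
    - by move=> u _ /=; rewrite addrA; exact: wf.
    - by rewrite /= gz.
    - by move=> u _ /=; rewrite addrA; exact: wg.
  move=> [_ [[[wM wf] gz] wg]].
  have wg' : proxsubg (gvalue D s w) (zpart w) (gamma^-1 *: (ypart w - zpart w) - ppart w).
    by move=> u; have := wg u I; rewrite /= addrA.
  split; first by split=> // u; have := wf u I; rewrite /= addrA.
  split=> //; apply/eqP; rewrite eq_le gz /=.
  have := wg' (zpart w); rewrite subrr sqr_enorm /dot !big1 ?mulr0 ?subr0 ?addr0 // => i _.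
    by rewrite !mxE mulr0.
  by rewrite !mxE mulr0.
apply: compact_closedI => //; apply: closedI; [apply: closedI; [apply: closedI|]|].
- by apply: closed_le_cont; apply: cpoly; poly_tac.
- apply: closed_bigI => u _; apply: closed_le_cont => w.
  apply: cvgD (cfy w) _; move: w.
  by apply: cpoly; rewrite /ypart /ppart; poly_tac.
- exact: closed_lsc_le.
- apply: closed_bigI => u _; have := gNy u; case: (g u) => [r||]// _; last first.
    rewrite (_ : [set w | _] = setT); first exact: closedT.
    by apply/seteqP; split=> // w _ /=; exact: leey.
  under eq_set do rewrite lee_fin.
  apply: closed_le_cont => w; apply: cvgD (cgv w) _; move: w.
  by apply: cpoly; rewrite /ypart /zpart /ppart; poly_tac.
Qed.

Lemma enorm_parts_le_l1dist v w :
  enorm (ypart v - ypart w) + enorm (zpart v - zpart w) + enorm (ppart v - ppart w)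
  <= l1dist v w.
Proof.
rewrite /l1dist !big_split_ord /= addrA.
apply: lerD; [apply: lerD|]; apply: le_trans (enorm_le_l1 _) _;
  by apply: ler_sum => i _; rewrite !mxE.
Qed.

(** The set of levels s whose level set is nonempty is semialgebraic and
    accumulates at 0, so it contains an interval ]0, eps[. *)
Lemma level_desingularization D M : continuous f -> lower_semicontinuous g ->
  (forall u, (-oo < g u)%E) -> semifun f ->
  semialg [set p : 'rV[R]_n * R | g p.1 = p.2%:E] ->
  (forall d, 0 < d -> exists s w,
    [/\ 0 < s < d, level_set D M s w & enorm (zpart w - ypart w) < d]) ->
  exists d (V : R -> R) m, [/\ 0 < d, forall s, 0 < s < d -> m <= V s,
    forall a b, 0 < a -> a < b -> b < d -> V a <= V b &
    forall a b w, 0 < a -> a < b -> b < d -> level_set D M b w ->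
      b - a <= (gamma^-1 + 1 + `|l|) * enorm (zpart w - ypart w) * (V b - V a)].
Proof.
move=> cf glsc gNy sf sg small.
have sA : semialg_family (level_set D M) by exact: semialg_level_set.
have cA s : compact (level_set D M s) by exact: compact_level_set.
pose rho (w : 'rV[R]_(n + (n + n))) := enorm (zpart w - ypart w) ^+ 2.
have prho : polyfun rho by rewrite /rho /zpart /ypart; poly_tac.
have [eps eps0 A0] : exists2 eps, 0 < eps &
    forall s, 0 < s < eps -> level_set D M s !=set0.
  have : semialg (fun s => exists w, level_set D M s w) by exact: semialg_ex.
  move=> /semialg_germ[|] /near0_rightP[eps [eps0 Heps]].
    by exists eps => // s /andP[s0 se]; exact: Heps.
  have [s [w [/andP[s0 se] Aw _]]] := small _ eps0.
  by exfalso; apply: (Heps s); last by exists w.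
have sqrho w : Num.sqrt (rho w) = enorm (zpart w - ypart w).
  by rewrite sqrtr_sqr ger0_norm ?enorm_ge0.
have C0 : 0 < gamma^-1 + 1 + `|l|.
  by rewrite ltr_wpDr // ltr_wpDr // invr_gt0.
have [||||d [V [m [d0 Vm Vmono Vgap]]]] :=
    @desingularization _ _ (level_set D M) rho eps (Num.sqrt M) _ sA cA prho _ eps0 C0 A0.
- by move=> w; exact: sqr_ge0.
- move=> s w i [[wM _] _]; apply: le_trans (coord_le_enorm w i) _.
  by rewrite enormE ler_wsqrtr.
- move=> a b v w a0 ab [_ [gv _]] [[_ wf] [gw wg]]; rewrite sqrho.
  have meritE s x : merit gamma (f (ypart x)) (gvalue D s x) (ypart x) (zpart x) (ppart x) = D + s.
    by rewrite /merit /gvalue; ring.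
  have := @merit_gap_le _ _ gamma gamma_gt0 l (f (ypart v)) (gvalue D a v)
    (ypart v) (zpart v) (ppart v) (f (ypart w)) (gvalue D b w)
    (ypart w) (zpart w) (ppart w) _ (wf _) _ (enorm_parts_le_l1dist w v).
  rewrite !meritE opprD addrACA subrr add0r; apply.
  by rewrite -lee_fin -gv; exact: wg.
- move=> eta d eta0 d0; pose e := Num.min d (Num.min eta 1).
  have e0 : 0 < e by rewrite !lt_min d0 eta0 ltr01.
  have [s [w [/andP[s0 se] Aw slope]]] := small _ e0.
  have [[ed eeta] e1] : (e <= d /\ e <= eta) /\ e <= 1.
    by rewrite /e !ge_min !lexx ?orbT.
  exists s, w; split=> //; first by rewrite s0 (lt_le_trans se).
  rewrite /rho expr2; have h0 := enorm_ge0 (zpart w - ypart w).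
  apply: le_lt_trans (_ : _ <= enorm (zpart w - ypart w) * 1) _.
    by rewrite ler_wpM2l //; lra.
  by rewrite mulr1; lra.
exists d, V, m; split=> // a b w a0 ab bd Aw.
by have := Vgap a b w a0 ab bd Aw; rewrite sqrho.
Qed.

End LevelSets.

(** * Finite length of the iteration *)

Section Sequences.
Variable R : realType.

Lemma bounded_nonincreasing_small_drop (v : nat -> R) t1 m (r : R) :
  0 < r -> (forall t, (t1 <= t)%N -> v t.+1 <= v t) ->
  (forall t, (t1 <= t)%N -> m <= v t) ->
  exists2 t0, (t1 <= t0)%N & forall t, (t0 <= t)%N -> v t0 - v t < r.
Proof.
move=> r0 dec vm; pose S := [set x | exists2 t, (t1 <= t)%N & x = v t].
have Sinf : has_inf S.
  split; first by exists (v t1), t1.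
  by exists m => x [t t1t ->]; exact: vm.
have [_ [t0 t1t0 ->] near_inf] := inf_adherent r0 Sinf.
exists t0 => // t t0t; rewrite ltrBlDr (lt_le_trans near_inf) // addrC lerD2l.
by apply: (ge_inf Sinf.2); exists t => //; exact: leq_trans t0t.
Qed.

(** Once the iterate is close to the cluster point and v has almost exhausted
    its decrease, the path still to be travelled is too short to leave the
    unit ball where steps are controlled by v. *)
Lemma finite_length_convergence n (Y : nat -> 'rV[R]_n) ys (v : nat -> R) t1 m :
  (forall t, (t1 <= t)%N -> v t.+1 <= v t) ->
  (forall t, (t1 <= t)%N -> m <= v t) ->
  (forall t, (t1 <= t)%N -> enorm (Y t - ys) <= 1 ->
     enorm (Y t.+1 - Y t) <= v t - v t.+1) ->
  (forall r N, 0 < r -> exists2 t, (N <= t)%N & enorm (Y t - ys) < r) ->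
  forall r, 0 < r -> exists N, forall t, (N <= t)%N -> enorm (Y t - ys) < r.
Proof.
move=> dec vm step clu r r0; pose q := Num.min r 1.
have q0 : 0 < q by rewrite lt_min r0 ltr01.
have [qr q1] : q <= r /\ q <= 1 by rewrite /q !ge_min !lexx orbT.
have q2 : 0 < q / 2 by lra.
have [t0 t1t0 drop] := bounded_nonincreasing_small_drop q2 dec vm.
have [t2 t0t2 Yt2] := clu _ t0 q2.
have t1t2 := leq_trans t1t0 t0t2.
have v02 : v t2 <= v t0.
  rewrite -(subnKC t0t2); elim: (t2 - t0)%N => [|k IH]; first by rewrite addn0.
  by rewrite addnS (le_trans (dec _ _)) // (leq_trans t1t0) // leq_addr.
have near k : enorm (Y (t2 + k)%N - Y t2) <= v t2 - v (t2 + k)%N.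
  elim: k => [|k IH]; first by rewrite addn0 !subrr enorm0.
  have t2k : (t1 <= t2 + k)%N by rewrite (leq_trans t1t2) // leq_addr.
  have d0k := drop (t2 + k)%N (leq_trans t0t2 (leq_addr _ _)).
  have ball : enorm (Y (t2 + k)%N - ys) <= 1.
    by have := enorm_split (Y t2) (Y (t2 + k)%N) ys; lra.
  have := step _ t2k ball; rewrite addnS.
  by have := enorm_split (Y (t2 + k)%N) (Y (t2 + k).+1) (Y t2); lra.
exists t2 => t /subnKC <-; set k := (t - t2)%N.
have d0k := drop (t2 + k)%N (leq_trans t0t2 (leq_addr _ _)).
by have := enorm_split (Y t2) (Y (t2 + k)%N) ys; have := near k; lra.
Qed.

(** The sequences Y, Z and P stand for y, z and grad f y, shifted by one index:
    the point x is recovered as Z + gamma P. *)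
Section ProximalPair.
Variables (n : nat) (f : 'rV[R]_n -> R) (g : 'rV[R]_n -> \bar R).
Variables (l gamma L K : R) (Y Z P : nat -> 'rV[R]_n) (gz : nat -> R).
Variables ys zs : 'rV[R]_n.
Hypothesis gamma_gt0 : 0 < gamma.
Hypothesis L_gt0 : 0 < L.
Hypothesis K_gt0 : 0 < K.
Hypothesis gZ : forall t, g (Z t) = (gz t)%:E.
Hypothesis fsub : forall t, proxsubf f l (Y t) (P t).
Hypothesis gsub : forall t,
  proxsubg g gamma (gz t) (Z t) (gamma^-1 *: (Y t - Z t) - P t).
Hypothesis Plip : forall s t, enorm (P s - P t) <= L * enorm (Y s - Y t).
Hypothesis ZPY : forall t, Z t + gamma *: P t = Y t.+1 + gamma *: P t.+1.
Hypothesis gap : forall t, gamma * enorm (P t.+1 - P t) ^+ 2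
  - ((2 * gamma)^-1 - l / 2) * enorm (Y t.+1 - Y t) ^+ 2
  <= - K * enorm (Y t.+1 - Y t) ^+ 2.
Hypothesis cluster_YZ : forall (r : R) N, 0 < r ->
  exists2 t, (N <= t)%N & enorm (Y t - ys) < r /\ enorm (Z t - zs) < r.

Definition meritseq t := merit gamma (f (Y t)) (gz t) (Y t) (Z t) (P t).
Definition steplen t := enorm (Y t.+1 - Y t).

Lemma meritseq_descent t : meritseq t.+1 + K * steplen t ^+ 2 <= meritseq t.
Proof.
have gle : gz t.+1 + dot (gamma^-1 *: (Y t.+1 - Z t.+1) - P t.+1) (Z t - Z t.+1)
    - (2 * gamma)^-1 * enorm (Z t - Z t.+1) ^+ 2 <= gz t.
  by have := gsub t.+1 (Z t); rewrite gZ lee_fin.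
have := le_trans (merit_descent gamma_gt0 (fsub t.+1 (Y t)) gle (ZPY t)) (gap t).
by rewrite /meritseq /steplen; lra.
Qed.

Lemma meritseq_le s t : (s <= t)%N -> meritseq t <= meritseq s.
Proof.
move=> st; rewrite -(subnKC st); elim: (t - s)%N => [|k IH]; first by rewrite addn0.
rewrite addnS; apply: (le_trans _ IH); apply: (le_trans _ (meritseq_descent (s + k))).
by rewrite lerDl mulr_ge0 ?sqr_ge0 // ltW.
Qed.

Lemma Z_sub_Y t : Z t - Y t = (Y t.+1 - Y t) + gamma *: (P t.+1 - P t).
Proof.
by apply/rowP => i; have /rowP/(_ i) := ZPY t; rewrite !mxE; lra.
Qed.

Lemma ZY_step t : enorm (Z t - Y t) <= (1 + gamma * L) * steplen t.
Proof.
rewrite Z_sub_Y; apply: le_trans (enormD _ _) _; rewrite mulrDl mul1r lerD2l enormZ.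
by rewrite gtr0_norm // -mulrA ler_pM2l // Plip.
Qed.

(** The subgradient inequalities at index 0 bound f and g from below by
    quadratic functions, which are bounded along the iterates that stay close
    to the cluster point; a nonincreasing sequence needs no more. *)
Lemma meritseq_bounded_below : exists m, forall t, m <= meritseq t.
Proof.
pose a := enorm (ys - Y 0) + 1; pose b := enorm (zs - Z 0) + 1.
pose q := gamma^-1 *: (Y 0%N - Z 0%N) - P 0%N.
pose e := enorm (zs - ys) + 2; pose c := L * a + enorm (P 0%N).
have a0 : 0 <= a by rewrite addr_ge0 ?enorm_ge0.
have b0 : 0 <= b by rewrite addr_ge0 ?enorm_ge0.
pose m := f (Y 0%N) - enorm (P 0%N) * a - `|l| * a ^+ 2
  + (gz 0%N - enorm q * b - (2 * gamma)^-1 * b ^+ 2) - e * c.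
exists m => t0.
have [t tt0 [Yt Zt]] := cluster_YZ t0 ltr01.
apply: le_trans (meritseq_le tt0); rewrite /meritseq /merit.
have Ya : enorm (Y t - Y 0%N) <= a.
  by rewrite /a; have := enorm_split ys (Y t) (Y 0%N); lra.
have Zb : enorm (Z t - Z 0%N) <= b.
  by rewrite /b; have := enorm_split zs (Z t) (Z 0%N); lra.
have Ee : enorm (Z t - Y t) <= e.
  have := enorm_split zs (Z t) (Y t); have := enorm_split ys zs (Y t).
  by rewrite (enormC ys (Y t)) /e; lra.
have Pc : enorm (P t) <= c.
  rewrite -[P t](subrK (P 0%N)); apply: le_trans (enormD _ _) _; rewrite lerD2r.
  by apply: le_trans (Plip _ _) _; rewrite ler_pM2l.
have Bf : f (Y 0%N) - enorm (P 0%N) * a - `|l| * a ^+ 2 <= f (Y t).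
  apply: le_trans (fsub 0%N (Y t)); apply: lerB.
    rewrite lerD2l lerNl -dotNr; apply: le_trans (dot_le _ _) _.
    by rewrite enormN ler_wpM2l ?enorm_ge0.
  have le2 : enorm (Y t - Y 0%N) ^+ 2 <= a ^+ 2 by rewrite ler_pXn2r ?nnegrE ?enorm_ge0.
  have l_le := ler_norm l; have l0 := normr_ge0 l.
  apply: (@le_trans _ _ (`|l| * enorm (Y t - Y 0%N) ^+ 2)); last by rewrite ler_wpM2l.
  by rewrite ler_wpM2r ?sqr_ge0 //; lra.
have Bg : gz 0%N - enorm q * b - (2 * gamma)^-1 * b ^+ 2 <= gz t.
  have := gsub 0%N (Z t); rewrite gZ lee_fin -/q; apply: le_trans; apply: lerB.
    rewrite lerD2l lerNl -dotNr; apply: le_trans (dot_le _ _) _.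
    by rewrite enormN ler_wpM2l ?enorm_ge0.
  by rewrite ler_pM2l ?invr_gt0 ?mulr_gt0 // ler_pXn2r ?nnegrE ?enorm_ge0.
have Bd : - (e * c) <= dot (Z t - Y t) (P t).
  rewrite lerNl -dotNr; apply: le_trans (dot_le _ _) _; rewrite enormN.
  by apply: ler_pM; rewrite ?enorm_ge0.
have Bq : 0 <= (2 * gamma)^-1 * enorm (Z t - Y t) ^+ 2.
  by rewrite mulr_ge0 ?sqr_ge0 // invr_ge0 mulr_ge0 // ltW.
by rewrite /m; lra.
Qed.

Hypothesis f_cont : continuous f.
Hypothesis g_lsc : lower_semicontinuous g.
Hypothesis gNy : forall u, (-oo < g u)%E.
Hypothesis f_semi : semifun f.
Hypothesis g_semi : semialg [set p : 'rV[R]_n * R | g p.1 = p.2%:E].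

Lemma step_small r : 0 < r -> exists N, forall t, (N <= t)%N -> steplen t < r.
Proof.
move=> r0; have [m mP] := meritseq_bounded_below.
have Kr0 : 0 < K * r ^+ 2 by rewrite mulr_gt0 // exprn_gt0.
have [N _ drop] := bounded_nonincreasing_small_drop (v := meritseq) (t1 := 0) Kr0
  (fun t _ => meritseq_le (leqnSn t)) (fun t _ => mP t).
exists N => t Nt.
have := drop t.+1 (leqW Nt); have := meritseq_descent t; have := meritseq_le Nt.
move=> ? ? ?; have : K * steplen t ^+ 2 < K * r ^+ 2 by lra.
by rewrite ltr_pM2l // ltr_pXn2r ?nnegrE ?enorm_ge0 // ltW.
Qed.

(** Let s_t be the excess of the merit value over its infimum. The descent gives
    K |dY|^2 <= s_t - s_(t+1), desingularization bounds the right hand side by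
    a constant times the slope times V s_t - V s_(t+1), and the slope |Z - Y|
    is at most a constant times |dY|. Dividing by |dY| bounds each step by a
    telescoping difference, as long as the iterate stays in a ball. *)
Theorem proximal_pair_convergence r : 0 < r -> exists N, forall t, (N <= t)%N ->
  enorm (Y t - ys) < r.
Proof.
have clu q N : 0 < q -> exists2 t, (N <= t)%N & enorm (Y t - ys) < q.
  by move=> /(cluster_YZ N)[t Nt [Yt _]]; exists t.
have [m mP] := meritseq_bounded_below.
pose D := inf (range meritseq).
have infD : has_inf (range meritseq).
  by split; [exists (meritseq 0), 0|exists m => _ [t _ <-]].
have DleM t : D <= meritseq t by apply: (ge_inf infD.2); exists t.
have Dnear q : 0 < q -> exists N, forall t, (N <= t)%N -> meritseq t < D + q.
  move=> q0; have [_ [N _ <-] HN] := inf_adherent q0 infD.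
  by exists N => t Nt; exact: le_lt_trans (meritseq_le Nt) HN.
have [[T MT]|Mgt] := pselect (exists T, meritseq T = D).
  (* after reaching the infimum the merit value, hence Y, stays constant, and
     levels equal to 0 are out of reach of desingularization *)
  apply: (@finite_length_convergence _ _ _ (fun=> 0) T 0) => // t Tt _.
  have := meritseq_descent t; have := DleM t.+1; have := meritseq_le Tt; rewrite MT.
  move=> ? ? ?; have : K * steplen t ^+ 2 <= K * 0 by lra.
  rewrite ler_pM2l // subrr => le0; rewrite -/(steplen t).
  have : steplen t ^+ 2 == 0 by rewrite eq_le le0 sqr_ge0.
  by rewrite sqrf_eq0 => /eqP ->.
pose s t := meritseq t - D.
have s0 t : 0 < s t.
  by rewrite subr_gt0 lt_def DleM andbT; apply/eqP => MD; apply: Mgt; exists t.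
have s_le t : s t.+1 <= s t by rewrite lerD2r meritseq_le.
have s_small q : 0 < q -> exists N, forall t, (N <= t)%N -> s t < q.
  by move=> /Dnear[N HN]; exists N => t /HN; rewrite /s; lra.
pose B := enorm ys + 1; pose Bz := B + (1 + gamma * L).
pose Bp := enorm (P 0%N) + L * (B + enorm (Y 0%N)).
pose M := (B + Bz + Bp) ^+ 2.
pose w t : 'rV[R]_(n + (n + n)) := row_mx (Y t) (row_mx (Z t) (P t)).
have yw t : ypart (w t) = Y t by rewrite /ypart row_mxKl.
have zw t : zpart (w t) = Z t by rewrite /zpart row_mxKr row_mxKl.
have pw t : ppart (w t) = P t by rewrite /ppart row_mxKr row_mxKr.
have gL0 : 0 < gamma * L by rewrite mulr_gt0.
have level t : enorm (Y t - ys) <= 1 -> steplen t <= 1 ->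
    level_set f g l gamma D M (s t) (w t).
  move=> Yt st.
  have gvE : gvalue f gamma D (s t) (w t) = gz t.
    by rewrite /gvalue yw zw pw /s /meritseq /merit; ring.
  rewrite /level_set /= gvE yw zw pw; split; last by split; [exact: gZ|exact: gsub].
  split; last exact: fsub.
  have YB : enorm (Y t) <= B.
    by rewrite -[Y t](subrK ys); have := enormD (Y t - ys) ys; rewrite /B; lra.
  have ZB : enorm (Z t) <= Bz.
    rewrite -[Z t](subrK (Y t)); have := enormD (Z t - Y t) (Y t).
    have := ZY_step t; have : (1 + gamma * L) * steplen t <= (1 + gamma * L) * 1.
      by rewrite ler_wpM2l //; lra.
    by rewrite /Bz; lra.
  have PB : enorm (P t) <= Bp.
    rewrite -[P t](subrK (P 0%N)); have := enormD (P t - P 0%N) (P 0%N).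
    have := Plip t 0; have : L * enorm (Y t - Y 0%N) <= L * (B + enorm (Y 0%N)).
      by rewrite ler_pM2l //; have := enormB (Y t) (Y 0%N); lra.
    by rewrite /Bp; lra.
  have -> : dot (w t) (w t) = enorm (Y t) ^+ 2 + enorm (Z t) ^+ 2 + enorm (P t) ^+ 2.
    rewrite !sqr_enorm /dot !big_split_ord /= addrA.
    by congr (_ + _ + _); apply: eq_bigr => i _; rewrite /w ?row_mxEl ?row_mxEr ?row_mxEl ?row_mxEr.
  have [y0 z0 p0] := And3 (enorm_ge0 (Y t)) (enorm_ge0 (Z t)) (enorm_ge0 (P t)).
  apply: (@le_trans _ _ ((enorm (Y t) + enorm (Z t) + enorm (P t)) ^+ 2)).
    rewrite [X in _ <= X](_ : _ = enorm (Y t) ^+ 2 + enorm (Z t) ^+ 2 + enorm (P t) ^+ 2 +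
      2 * (enorm (Y t) * enorm (Z t) + enorm (Y t) * enorm (P t) +
           enorm (Z t) * enorm (P t))); last by ring.
    by rewrite lerDl mulr_ge0 // !addr_ge0 // mulr_ge0.
  have sum_le : enorm (Y t) + enorm (Z t) + enorm (P t) <= B + Bz + Bp.
    by apply: lerD => //; apply: lerD.
  have sum0 : 0 <= enorm (Y t) + enorm (Z t) + enorm (P t) by rewrite !addr_ge0.
  by rewrite /M ler_pXn2r // nnegrE // (le_trans sum0).
have [d d0 [V [m' [Vm Vmono Vgap]]]] : exists2 d, 0 < d & exists (V : R -> R) m,
    [/\ forall s, 0 < s < d -> m <= V s,
    forall a b, 0 < a -> a < b -> b < d -> V a <= V b &
    forall a b w, 0 < a -> a < b -> b < d -> level_set f g l gamma D M b w ->
      b - a <= (gamma^-1 + 1 + `|l|) * enorm (zpart w - ypart w) * (V b - V a)].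
  have [|d [V [m' [d0 HV1 HV2 HV3]]]] := @level_desingularization _ _ f g l gamma
    gamma_gt0 D M f_cont g_lsc gNy f_semi g_semi; last by exists d => //; exists V, m'.
  move=> q q0; pose q' := Num.min (q / (1 + gamma * L)) 1.
  have gL1 : 0 < 1 + gamma * L by lra.
  have q'0 : 0 < q' by rewrite lt_min ltr01 divr_gt0.
  have [N1 HN1] := s_small _ q0; have [N2 HN2] := step_small q'0.
  have [t + Yt] := clu 1 (maxn N1 N2) ltr01; rewrite geq_max => /andP[/HN1 sq /HN2].
  rewrite lt_min => /andP[stq st1].
  exists (s t), (w t); split; [by rewrite s0|by apply: level; exact: ltW|].
  rewrite yw zw; apply: le_lt_trans (ZY_step t) _.
  by rewrite mulrC -ltr_pdivlMr.
have [N1 HN1] := s_small _ d0; have [N2 HN2] := step_small (ltr01).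
pose Q := (gamma^-1 + 1 + `|l|) * (1 + gamma * L) / K.
have C0 : 0 < gamma^-1 + 1 + `|l| by rewrite ltr_wpDr // ltr_wpDr // invr_gt0.
have Q0 : 0 < Q by rewrite divr_gt0 // mulr_gt0 //; lra.
have V_le t : (maxn N1 N2 <= t)%N -> V (s t.+1) <= V (s t).
  rewrite geq_max => /andP[/HN1 sd _].
  by have := s_le t; rewrite le_eqVlt => /predU1P[->//|lts]; exact: Vmono.
apply: (@finite_length_convergence _ _ _ (fun t => Q * V (s t)) (maxn N1 N2) (Q * m')) => //.
- by move=> t /V_le ?; rewrite ler_pM2l.
- by move=> t; rewrite geq_max => /andP[/HN1 sd _]; rewrite ler_pM2l // Vm // s0.
- move=> t tN Yt; have VV := V_le t tN.
  move: tN; rewrite geq_max => /andP[/HN1 sd /HN2 st1].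
  rewrite -/(steplen t) -mulrBr.
  have desc : K * steplen t ^+ 2 <= s t - s t.+1.
    by have := meritseq_descent t; rewrite /s; lra.
  have [->|stp] := eqVneq (steplen t) 0; first by rewrite mulr_ge0 ?subr_ge0 // ltW.
  have st0 : 0 < steplen t by rewrite lt_def stp enorm_ge0.
  have slt : s t.+1 < s t.
    have : 0 < K * steplen t ^+ 2 by rewrite mulr_gt0 // exprn_gt0.
    by lra.
  have := Vgap _ _ _ (s0 t.+1) slt sd (level t Yt (ltW st1)); rewrite yw zw.
  move=> /(le_trans desc) le1.
  have DV0 : 0 <= V (s t) - V (s t.+1) by rewrite subr_ge0.
  have : steplen t * (steplen t * K) <=
      steplen t * ((gamma^-1 + 1 + `|l|) * (1 + gamma * L) * (V (s t) - V (s t.+1))).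
    have -> : steplen t * (steplen t * K) = K * steplen t ^+ 2 by ring.
    apply: (le_trans le1).
    rewrite [X in _ <= X](_ : _ = (gamma^-1 + 1 + `|l|) *
      ((1 + gamma * L) * steplen t) * (V (s t) - V (s t.+1))); last by ring.
    by rewrite ler_wpM2r // ler_pM2l // ZY_step.
  by rewrite ler_pM2l // => le2; rewrite /Q mulrAC ler_pdivlMr.
Qed.

End ProximalPair.
End Sequences.

(** * Optimality conditions of the two subproblems *)

Section Subgradients.
Variables (R : realType) (n : nat).
Implicit Types (x y z p : 'rV[R]_n).

Lemma ge0_of_affine_ge0 (a b : R) :
  (forall t, 0 < t -> t < 1 -> 0 <= a + t * b) -> 0 <= a.
Proof.
move=> ab; rewrite leNgt; apply/negP => a0; pose t := - a / (- a + `|b| + 1).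
have q0 : 0 < - a + `|b| + 1 by have := normr_ge0 b; lra.
have t0 : 0 < t by rewrite divr_gt0 // oppr_gt0.
have t1 : t < 1 by rewrite ltr_pdivrMr //; have := normr_ge0 b; lra.
have tb : t * b < - a.
  apply: le_lt_trans (ler_wpM2l (ltW t0) (ler_norm b)) _.
  by rewrite mulrAC ltr_pdivrMr // ltr_pM2l ?oppr_gt0 //; lra.
by have := ab t t0 t1; lra.
Qed.

(** Compare the minimizer y with the points of the segment from y to u: by
    convexity the first-order term in the position on the segment must be
    nonnegative. *)
Lemma argmin_proxsubf (f : 'rV[R]_n -> R) (l gamma : R) x y : 0 < gamma ->
  convex_function setT (fun u => f u + l / 2 * enorm u ^+ 2) ->
  argmin (fun u => f u + (2 * gamma)^-1 * enorm (u - x) ^+ 2) y ->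
  proxsubf f l y (gamma^-1 *: (x - y)).
Proof.
move=> g0 fcvx ymin u; rewrite -subr_ge0.
apply: (@ge0_of_affine_ge0 _ (((2 * gamma)^-1 - l / 2) * enorm (u - y) ^+ 2)) => t t0 t1.
have fconv : f (t *: u + (1 - t) *: y) + l / 2 * enorm (t *: u + (1 - t) *: y) ^+ 2 <=
    t * (f u + l / 2 * enorm u ^+ 2) + (1 - t) * (f y + l / 2 * enorm y ^+ 2).
  exact: (fcvx (Itv01 (ltW t0) (ltW t1)) u y (mem_set I) (mem_set I)).
have := ymin (t *: u + (1 - t) *: y).
rewrite -subr_ge0 => ymin_t; rewrite -(pmulr_rge0 _ t0).
have quad1 : l / 2 * enorm (t *: u + (1 - t) *: y) ^+ 2 =
    t * (l / 2 * enorm u ^+ 2) + (1 - t) * (l / 2 * enorm y ^+ 2) +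
    - (l / 2 * t * (1 - t) * enorm (u - y) ^+ 2).
  rewrite !sqr_enorm /dot !mulr_sumr -!sumrN -!big_split; apply: eq_bigr => i _ /=.
  by rewrite !mxE; field.
have quad2 : (2 * gamma)^-1 * enorm (t *: u + (1 - t) *: y - x) ^+ 2 =
    (2 * gamma)^-1 * enorm (y - x) ^+ 2 +
    - (t * dot (gamma^-1 *: (x - y)) (u - y)) +
    (2 * gamma)^-1 * t ^+ 2 * enorm (u - y) ^+ 2.
  rewrite !sqr_enorm /dot !mulr_sumr -!sumrN -!big_split; apply: eq_bigr => i _ /=.
  by rewrite !mxE; field; rewrite gt_eqF.
move: fconv ymin_t; rewrite quad1 quad2.
by move: (f u) (f y) (f _) (enorm u ^+ 2) (enorm y ^+ 2) (enorm (u - y) ^+ 2)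
  (enorm (y - x) ^+ 2) (dot _ _) (2 * gamma)^-1 => *; lra.
Qed.

Lemma grad_proxsubf (f : 'rV[R]_n -> R) (l : R) y p :
  differentiable f y -> proxsubf f l y p -> grad f y = p.
Proof.
move=> df fsub; apply/rowP => i; rewrite mxE; set e := delta_mx 0 i.
have pe : dot p e = p 0 i.
  rewrite /dot (bigD1 i) //= big1 ?addr0 ?mxE ?eqxx ?mulr1 // => j ji.
  by rewrite mxE (negbTE ji) andbF mulr0.
have ee : enorm e = 1.
  rewrite enormE /dot (bigD1 i) //= big1 ?addr0 ?mxE ?eqxx ?mulr1 ?sqrtr1 // => j ji.
  by rewrite mxE (negbTE ji) andbF mulr0.
have lower h : h * p 0 i - l / 2 * h ^+ 2 <= f (h *: e + y) - f y.
  have := fsub (h *: e + y); rewrite addrK dotZr pe enormZ ee mulr1 real_normK ?num_real //.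
  by lra.
have approx (r : R) : 0 < r -> exists2 h, 0 < h < r &
    (h * ('D_e f y - p 0 i) >= - (h * r) - l / 2 * h ^+ 2) /\
    (h * ('D_e f y - p 0 i) <= h * r + l / 2 * h ^+ 2).
  move=> r0; have /cvgrPdist_lt/(_ r r0)/nbhs_ballP[d /= d0 Hd] := @diff_derivable _ _ _ f y e df.
  pose h := Num.min (d / 2) (r / 2).
  have h0 : 0 < h by rewrite lt_min; lra.
  have [hd hr] : h <= d / 2 /\ h <= r / 2 by rewrite /h !ge_min !lexx orbT.
  have quot s : s != 0 -> `|s| < d -> `|'D_e f y - s^-1 * (f (s *: e + y) - f y)| < r.
    by move=> s0 sd; apply: Hd => //; rewrite /ball /= sub0r normrN.
  exists h; first by lra.
  have hdd : `|h| < d by rewrite gtr0_norm //; lra.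
  have := quot h (lt0r_neq0 h0) hdd.
  have := quot (- h); rewrite oppr_eq0 normrN (lt0r_neq0 h0) => /(_ isT hdd).
  have := lower h; have := lower (- h); rewrite sqrrN invrN !mulNr.
  move: ('D_e f y) (f (h *: e + y) - f y) (f (- h *: e + y) - f y) => D A B.
  move=> LB LA; rewrite !ltr_norml => /andP[_ QB] /andP[QA _].
  have hA : h * (h^-1 * A) = A by rewrite mulrA divff ?mul1r // lt0r_neq0.
  have hB : h * (h^-1 * B) = B by rewrite mulrA divff ?mul1r // lt0r_neq0.
  have : h * (- r) < h * (D - h^-1 * A) by rewrite ltr_pM2l.
  have : h * (D - - (h^-1 * B)) < h * r by rewrite ltr_pM2l.
  by rewrite !mulrBr !mulrN hA hB => *; split; lra.
apply/eqP; rewrite -subr_eq0 -normr_le0; apply/ler_addgt0Pr => r r0; rewrite add0r.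
have q0 : 0 < 1 + `|l| by have := normr_ge0 l; lra.
have [h /andP[h0 hr] [lo up]] := approx (r / (1 + `|l|)) (divr_gt0 r0 q0).
have hl : l / 2 * h ^+ 2 <= h * (`|l| * h).
  have : l * h ^+ 2 <= `|l| * h ^+ 2 by rewrite ler_wpM2r ?sqr_ge0 // ler_norm.
  have : 0 <= `|l| * h ^+ 2 by rewrite mulr_ge0 ?sqr_ge0.
  by rewrite expr2; lra.
have hq : `|l| * h <= `|l| * (r / (1 + `|l|)) by rewrite ler_wpM2l // ltW.
have sum : r / (1 + `|l|) + `|l| * (r / (1 + `|l|)) = r by field; rewrite gt_eqF.
have hh : h * (`|l| * h) <= h * (`|l| * (r / (1 + `|l|))) by rewrite ler_pM2l.
rewrite -(ler_pM2l h0) -[X in X * _](gtr0_norm h0) -normrM ler_norml -sum mulrDr.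
by apply/andP; split; lra.
Qed.

(** Expanding the two squares in the inequality expressing minimality of z
    leaves a linear term in u - z and the square of u - z. *)
Lemma argmin_proxsubg (g : 'rV[R]_n -> \bar R) (gamma : R) x y z : 0 < gamma ->
  (forall u, (-oo < g u)%E) -> (exists u, (g u < +oo)%E) ->
  argmin (fun u => (g u +
    ((2 * gamma)^-1 * enorm (2 *: y - x - u) ^+ 2)%:E)%E) z ->
  exists2 gz, g z = gz%:E &
    proxsubg g gamma gz z (gamma^-1 *: (y - z) - gamma^-1 *: (x - y)).
Proof.
move=> g0 gNy [u0 gu0] zmin.
have [gz gzE] : exists gz, g z = gz%:E.
  have := zmin u0; have := gNy z; have := gNy u0; move: gu0.
  by case: (g u0) => [a||] //; case: (g z) => [b||] // _ _ _ _; exists b.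
exists gz => // u; have := zmin u; rewrite /= gzE.
have := gNy u; case: (g u) => [a||//] _; last by move=> _; exact: leey.
rewrite -!EFinD !lee_fin.
suff -> : dot (gamma^-1 *: (y - z) - gamma^-1 *: (x - y)) (u - z) =
    (2 * gamma)^-1 * enorm (2 *: y - x - z) ^+ 2
    - (2 * gamma)^-1 * enorm (2 *: y - x - u) ^+ 2 + (2 * gamma)^-1 * enorm (u - z) ^+ 2.
  by lra.
rewrite !sqr_enorm /dot !mulr_sumr -!sumrN -!big_split; apply: eq_bigr => i _ /=.
by rewrite !mxE; field; rewrite gt_eqF.
Qed.

Lemma enorm_cvg (u : nat -> 'rV[R]_n) (a : 'rV[R]_n) :
  (forall r, 0 < r -> exists N, forall t, (N <= t)%N -> enorm (u t.+1 - a) < r) ->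
  u t @[t --> \oo] --> a.
Proof.
move=> ua; apply/cvgrPdist_lt => r r0; have [N HN] := ua r r0.
exists N.+1 => // -[//|t] /= Nt; apply: le_lt_trans (HN t Nt).
rewrite distrC [X in X <= _]mx_normrE; apply: bigmax_le => [|[i j] _ /=].
  exact: enorm_ge0.
by rewrite ord1; exact: coord_le_enorm.
Qed.

Lemma nbhs_enorm (a : 'rV[R]_n) (r : R) : 0 < r -> nbhs a [set v | enorm (v - a) < r].
Proof.
move=> r0; have cq : continuous (fun v : 'rV[R]_n => enorm (v - a) ^+ 2).
  by apply: polyfun_continuous; poly_tac.
have nr : \forall v \near a, enorm (v - a) ^+ 2 < r ^+ 2.
  by apply: (cvgr_lt _ (cq a)); rewrite subrr enorm0 expr0n exprn_gt0.
near=> v => /=.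
rewrite -(ltr_pXn2r (n := 2)) ?nnegrE ?enorm_ge0 ?(ltW r0) //.
by near: v.
Unshelve. all: by end_near. Qed.

End Subgradients.

(** * Convergence of Douglas-Rachford splitting *)

Theorem theorem2 (R : realType) (n : nat)
  (f : 'rV[R]_n -> R) (g : 'rV[R]_n -> \bar R) (L l gamma : R)
  (x0 : 'rV[R]_n) (y z x : nat -> 'rV[R]_n)
  (L_gt0 : 0 < L) (gamma_gt0 : 0 < gamma)
  (f_diff : forall u : 'rV[R]_n, differentiable f u)
  (f_C1 : continuous (grad f))
  (f_lip : forall u v : 'rV[R]_n,
     enorm (grad f u - grad f v) <= L * enorm (u - v))
  (f_cvx : convex_function setT (fun u => f u + l / 2 * enorm u ^+ 2))
  (g_ninfty : forall u, (-oo < g u)%E)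
  (g_proper : exists u, (g u < +oo)%E)
  (g_lsc : lower_semicontinuous g)
  (g_prox : forall w : 'rV[R]_n, exists u, argmin
     (fun u => (gamma%:E * g u + (1 / 2 * enorm (u - w) ^+ 2)%:E)%E) u)
  (yzx_DR : DR_sequence f g gamma x0 y z x)
  (gamma_small : (1 + gamma * L) ^+ 2 + 5 * gamma * l / 2 - 3 / 2 < 0)
  (yzx_cluster : exists ystar zstar xstar : 'rV[R]_n,
     cluster ((y t, z t, x t) @[t --> \oo]) (ystar, zstar, xstar))
  (f_semialg : semialgebraic_fun (EFin \o f))
  (g_semialg : semialgebraic_fun g) :
  exists ylim zlim xlim : 'rV[R]_n,
    (y t, z t, x t) @[t --> \oo] --> (ylim, zlim, xlim).
Proof.
have [_ DR] := yzx_DR; have [ys [zs [xs clu]]] := yzx_cluster.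
pose P t := gamma^-1 *: (x t - y t.+1).
have fsub t : proxsubf f l (y t.+1) (P t).
  by have [ymin _ _] := DR t; exact: argmin_proxsubf.
have gradP t : grad f (y t.+1) = P t by exact: grad_proxsubf (f_diff _) (fsub t).
have /choice[gz gzP] t : exists gz, g (z t.+1) = gz%:E /\
    proxsubg g gamma gz (z t.+1) (gamma^-1 *: (y t.+1 - z t.+1) - P t).
  by have [_ zmin _] := DR t; have [gz ? ?] :=
    argmin_proxsubg gamma_gt0 g_ninfty g_proper zmin; exists gz.
have xP t : x t = y t.+1 + gamma *: P t.
  by rewrite scalerA divff ?gt_eqF // scale1r addrC subrK.
have Plip s t : enorm (P s - P t) <= L * enorm (y s.+1 - y t.+1).
  by rewrite -!gradP.
have ZPY t : z t.+1 + gamma *: P t = y t.+2 + gamma *: P t.+1.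
  by rewrite -xP; have [_ _ ->] := DR t; rewrite xP; apply/rowP => i; rewrite !mxE; ring.
(* K |dy|^2 differs from the coefficient of descent by 2 (l + L) |dy|^2, which
   is nonnegative *)
pose K := - ((1 + gamma * L) ^+ 2 + 5 * gamma * l / 2 - 3 / 2) / gamma.
have K0 : 0 < K by rewrite divr_gt0 // oppr_gt0.
have gap t : gamma * enorm (P t.+1 - P t) ^+ 2
    - ((2 * gamma)^-1 - l / 2) * enorm (y t.+2 - y t.+1) ^+ 2
    <= - K * enorm (y t.+2 - y t.+1) ^+ 2.
  set e := enorm (y t.+2 - y t.+1).
  have P2 : enorm (P t.+1 - P t) ^+ 2 <= L ^+ 2 * e ^+ 2.
    rewrite -exprMn ler_pXn2r ?nnegrE ?enorm_ge0 ?Plip //.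
    by rewrite mulr_ge0 ?enorm_ge0 // ltW.
  (* grad f + l id is monotone and grad f is L-Lipschitz *)
  have lL : 0 <= (l + L) * e ^+ 2.
    have := fsub t (y t.+2); have := fsub t.+1 (y t.+1).
    rewrite (enormC (y t.+1)) -/e.
    have : dot (P t - P t.+1) (y t.+2 - y t.+1) >= - (L * e ^+ 2).
      rewrite lerNl -dotNr; apply: le_trans (dot_le _ _) _; rewrite enormN -/e expr2 mulrA.
      by rewrite ler_wpM2r ?enorm_ge0 // enormC Plip.
    have -> : dot (P t - P t.+1) (y t.+2 - y t.+1) =
        dot (P t) (y t.+2 - y t.+1) + dot (P t.+1) (y t.+1 - y t.+2).
      by rewrite /dot -big_split; apply: eq_bigr => i _ /=; rewrite !mxE; ring.
    by lra.
  have gP2 : gamma * enorm (P t.+1 - P t) ^+ 2 <= gamma * (L ^+ 2 * e ^+ 2) by rewrite ler_pM2l.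
  have KE : K * e ^+ 2 = ((2 * gamma)^-1 - 5 * l / 2 - 2 * L - gamma * L ^+ 2) * e ^+ 2.
    by rewrite /K; field; rewrite gt_eqF.
  by rewrite mulNr KE; lra.
have cluster_yz (r : R) N : 0 < r -> exists2 t, (N <= t)%N &
    enorm (y t.+1 - ys) < r /\ enorm (z t.+1 - zs) < r.
  move=> r0.
  have tail : ((y t, z t, x t) @[t --> \oo])
      [set q | exists2 t, (N <= t)%N & q = (y t.+1, z t.+1, x t.+1)].
    by exists N.+1 => // -[//|t] /= Nt; exists t.
  have near : nbhs (ys, zs, xs) [set q : 'rV[R]_n * 'rV[R]_n * 'rV[R]_n |
      enorm (q.1.1 - ys) < r /\ enorm (q.1.2 - zs) < r].
    exists ([set q : 'rV[R]_n * 'rV[R]_n | enorm (q.1 - ys) < r /\ enorm (q.2 - zs) < r], setT).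
      split; last exact: filterT.
      exists ([set v | enorm (v - ys) < r], [set v | enorm (v - zs) < r]).
        by split; exact: nbhs_enorm.
      by move=> [a b] [].
    by move=> [[a b] c] [].
  have [_ [[t Nt ->] [/= Yr Zr]]] := clu _ _ tail near.
  by exists t.
have f_cont : continuous f by move=> u; exact: differentiable_continuous.
have Yconv := @proximal_pair_convergence R n f g l gamma L K (fun t => y t.+1)
  (fun t => z t.+1) P gz ys zs gamma_gt0 L_gt0 K0 (fun t => (gzP t).1) fsub
  (fun t => (gzP t).2) Plip ZPY gap cluster_yz f_cont g_lsc g_ninfty
  (semialgebraic_semifun f_semialg) (semialgebraic_fun_graph g_semialg).
have Zconv (r : R) : 0 < r -> exists N, forall t, (N <= t)%N -> enorm (z t.+1 - ys) < r.
  move=> r0; have c0 : 0 < 1 + 2 * (gamma * L).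
    by have : 0 < gamma * L by [rewrite mulr_gt0]; lra.
  have [N HN] := Yconv (r / (1 + 2 * (gamma * L))) (divr_gt0 r0 c0).
  exists N => t Nt; have Y1 := HN t Nt; have Y2 := HN t.+1 (leqW Nt).
  have -> : z t.+1 - ys = (y t.+2 - ys) + gamma *: (P t.+1 - P t).
    by apply/rowP => i; have /rowP/(_ i) := ZPY t; rewrite !mxE; lra.
  apply: le_lt_trans (enormD _ _) _; rewrite enormZ gtr0_norm //.
  have := ler_wpM2l (ltW gamma_gt0) (Plip t.+1 t).
  have := enorm_split ys (y t.+2) (y t.+1); rewrite (enormC ys).
  move: Y1 Y2; rewrite !ltr_pdivlMr //.
  set a := enorm (y t.+2 - y t.+1); set b := enorm (y t.+2 - ys).
  set c := enorm (y t.+1 - ys); set p := enorm (P t.+1 - P t).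
  move=> cr br abc; have gL0 : 0 <= gamma * L by rewrite mulr_ge0 ?ltW.
  have := ler_wpM2l gL0 abc; have := enorm_ge0 (y t.+1 - ys); rewrite -/c => c0' ? ?.
  have [bc|cb] := leP b c.
    have := ler_wpM2l gL0 bc; lra.
  have := ler_wpM2l gL0 (ltW cb); lra.
have Xconv (r : R) : 0 < r -> exists N, forall t, (N <= t)%N ->
    enorm (x t.+1 - (ys + gamma *: grad f ys)) < r.
  move=> r0; have gL1 : 0 < 1 + gamma * L by rewrite ltr_wpDr // mulr_ge0 ?ltW.
  have [N HN] := Yconv (r / (1 + gamma * L)) (divr_gt0 r0 gL1).
  exists N => t Nt; have Y2 := HN t.+1 (leqW Nt).
  have -> : x t.+1 - (ys + gamma *: grad f ys) =
      (y t.+2 - ys) + gamma *: (grad f (y t.+2) - grad f ys).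
    by rewrite xP gradP; apply/rowP => i; rewrite !mxE; ring.
  apply: le_lt_trans (enormD _ _) _; rewrite enormZ gtr0_norm //.
  have := ler_wpM2l (ltW gamma_gt0) (f_lip (y t.+2) ys).
  by move: Y2; rewrite ltr_pdivlMr //; lra.
exists ys, ys, (ys + gamma *: grad f ys).
exact: cvg_pair (cvg_pair (enorm_cvg Yconv) (enorm_cvg Zconv)) (enorm_cvg Xconv).
Qed.
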